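(* Let $A$ and $B$ be representation-directed algebras, let $P$ be a left abutment of $A$ and $I$ a right abutment of $B$, both of the same height $h$. Then the gluing $\Lambda$ of $A$ and $B$ along $P$ and $I$ is representation-directed.
   Context: $K$ is an algebraically closed field; algebras are basic finite-dimensional unital associative $K$-algebras; modules are finite-dimensional right modules; $D=\operatorname{Hom}_K(-,K)$; paths are composed left to right. An algebra is representation-directed if there is no sequence of nonzero nonisomorphisms $M_0\to\cdots\to M_t$ ($t\ge1$) between indecomposable modules with $M_0\cong M_t$. Abutments. A left abutment of $A$ is a uniserial projective module $P$ such that every submodule of $P$ is projective and, for every indecomposable projective $P'$ not isomorphic to a submodule of $P$, every morphism $U\to P'$ with $U\subseteq P$ factors through the inclusion $U\subseteq P$. A realization of $P$ is $(e_i,f_i)_{i=1}^h$ with $e_1,\dots,e_h$ primitive orthogonal idempotents such that the composition series of $P$ is $0\xrightarrow{f_h=0}e_hA\xrightarrow{f_{h-1}}\cdots\xrightarrow{f_1}e_1A\cong P$, $f_i\in\operatorname{Hom}_A(e_{i+1}A,e_iA)=e_iAe_{i+1}$; $h$ is the height. An indecomposable injective $B$-module $I$ is a right abutment if $D(I)$ is a left abutment over $B^{\mathrm{op}}$; it has a realization $(\epsilon_i,g_{i-1})_{i=1}^h$: a chain of quotient maps $I\cong D(B\epsilon_h)\xrightarrow{g_{h-1}}\cdots\xrightarrow{g_1}D(B\epsilon_1)\xrightarrow{g_0=0}0$ dual to the composition series of $D(I)$, with $g_i$ regarded as an element of $\epsilon_iB\epsilon_{i+1}\cong\operatorname{Hom}_B(D(B\epsilon_{i+1}),D(B\epsilon_i))$;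 $h$ is its height. Gluing. $KA_h$ is the path algebra of $1\xrightarrow{\alpha_1}2\to\cdots\xrightarrow{\alpha_{h-1}}h$ with vertex idempotents $t_i$. For fixed realizations, $f_P:A\to KA_h$ is the unique algebra homomorphism with $1-\sum_ie_i\mapsto0$, $e_i\mapsto t_i$, $f_i\mapsto\alpha_i$, and $g_I:B\to KA_h$ is the unique algebra homomorphism with $1-\sum_i\epsilon_i\mapsto0$, $\epsilon_i\mapsto t_i$, $g_i\mapsto\alpha_i$ ($1\le i\le h-1$). The gluing of $A$ and $B$ along $P$ and $I$ is $\Lambda=\{(a,b)\in A\times B\mid f_P(a)=g_I(b)\}$. *)

(* Defs.v *)
From HB Require Import structures.
From mathcomp Require Import all_boot all_order all_algebra all_field.

Set Implicit Arguments.
Unset Strict Implicit.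
Unset Printing Implicit Defensive.

Import GRing.Theory.
Local Open Scope ring_scope.

(* On the opposite algebra A^c, whose carrier is that of A, the product of a  *)
(* and b is b * a.                                                            *)

Section OppositeAlgebra.
Variables (K : fieldType) (A : falgType K).

HB.instance Definition _ := Vector.copy A^c A.

Fact opp_scalerAl (k : K) (x y : A^c) :
  k *: (x * y : A^c) = (k *: x : A^c) * y.
Proof. exact: (@scalerAr K A k y x). Qed.
HB.instance Definition _ := GRing.Lmodule_isLalgebra.Build K A^c opp_scalerAl.

Fact opp_scalerAr (k : K) (x y : A^c) :
  k *: (x * y : A^c) = x * (k *: y : A^c).
Proof. exact: (@scalerAl K A k y x). Qed.
HB.instance Definition _ := GRing.Lalgebra_isAlgebra.Build K A^c opp_scalerAr.

Definition oppalg : falgType K := A^c.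

Lemma oppalg_mulE (a b : A) : (a : oppalg) * (b : oppalg) = b * a.
Proof. by []. Qed.

End OppositeAlgebra.

(* Here rmod_act a is the map x |-> x.a.                                      *)
Record rmodule (K : fieldType) (A : falgType K) := RModule {
  rmod_vect :> vectType K;
  rmod_act : {linear A -> 'End(rmod_vect)};
  rmod_act1 : rmod_act 1 = \1%VF;
  rmod_actM : forall a b, rmod_act (a * b) = (rmod_act b \o rmod_act a)%VF }.

Arguments rmod_act {K A} r.

Record submodule (K : fieldType) (A : falgType K) (M : rmodule A) := Submodule {
  sub_vspace :> {vspace M};
  sub_stable : forall a x, x \in sub_vspace -> rmod_act M a x \in sub_vspace }.

Section Modules.
Variables (K : fieldType) (A : falgType K).
Implicit Types (M N : rmodule A).

Definition rmhom M N (f : 'Hom(M, N)) : Prop :=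
  forall a x, f (rmod_act M a x) = rmod_act N a (f x).

Definition rmisomorphic M N : Prop :=
  exists f : 'Hom(M, N), rmhom f /\ bijective f.

Section SubmoduleModule.
Variables (M : rmodule A) (U : submodule M).

Definition sub_act (a : A) : 'End(subvs_of U) :=
  linfun (vsproj U \o (rmod_act M a \o vsval)).

Lemma sub_actE a x : vsval (sub_act a x) = rmod_act M a (vsval x).
Proof. by rewrite lfunE /= vsprojK // sub_stable // subvsP. Qed.

Fact sub_act_linear : linear sub_act.
Proof.
move=> k a b; apply/lfunP => x; apply: subvs_inj.
rewrite add_lfunE scale_lfunE /= !sub_actE.
by rewrite linearP add_lfunE scale_lfunE.
Qed.
HB.instance Definition _ := GRing.isLinear.Build K A 'End(subvs_of U) _
  sub_act sub_act_linear.

Fact sub_act1 : sub_act 1 = \1%VF.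
Proof.
by apply/lfunP => x; apply: subvs_inj; rewrite sub_actE rmod_act1 !id_lfunE.
Qed.

Fact sub_actM a b : sub_act (a * b) = (sub_act b \o sub_act a)%VF.
Proof.
apply/lfunP => x; apply: subvs_inj.
by rewrite comp_lfunE !sub_actE rmod_actM comp_lfunE.
Qed.

Definition submod : rmodule A := RModule sub_act1 sub_actM.

End SubmoduleModule.

Definition indecomposable M : Prop :=
  (fullv : {vspace M}) <> 0%VS /\
  forall U V : submodule M, (U + V)%VS = fullv -> (U :&: V)%VS = 0%VS ->
    U = 0%VS :> {vspace M} \/ V = 0%VS :> {vspace M}.

Definition simple_mod M : Prop :=
  (fullv : {vspace M}) <> 0%VS /\
  forall U : submodule M, U = 0%VS :> {vspace M} \/ U = fullv :> {vspace M}.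

Definition uniserial M : Prop :=
  forall U V : submodule M, (U <= V)%VS \/ (V <= U)%VS.

Definition projective_mod (P : rmodule A) : Prop :=
  forall M N (p : 'Hom(M, N)) (f : 'Hom(P, N)),
    rmhom p -> limg p = fullv -> rmhom f ->
    exists g : 'Hom(P, M), rmhom g /\ (p \o g)%VF = f.

Definition injective_mod (I : rmodule A) : Prop :=
  forall M N (i : 'Hom(M, N)) (f : 'Hom(M, I)),
    rmhom i -> lker i = 0%VS -> rmhom f ->
    exists g : 'Hom(N, I), rmhom g /\ (g \o i)%VF = f.

Definition left_abutment (P : rmodule A) : Prop :=
  [/\ uniserial P,
      projective_mod P,
      forall U : submodule P, projective_mod (submod U)
    & forall P' : rmodule A, indecomposable P' -> projective_mod P' ->
        ~ (exists U : submodule P, rmisomorphic P' (submod U)) ->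
        forall (U : submodule P) (f : 'Hom(submod U, P')), rmhom f ->
          exists g : 'Hom(P, P'), rmhom g /\ forall x, f x = g (vsval x)].

End Modules.

(* The regular module A_A and its submodules eA.                              *)

Section Regular.
Variables (K : fieldType) (A : falgType K).

Fact regular_act1 : amulr (1 : A) = \1%VF.
Proof. by apply/lfunP => x; rewrite lfunE id_lfunE /= mulr1. Qed.

Fact regular_actM (a b : A) : amulr (a * b) = (amulr b \o amulr a)%VF.
Proof. by apply/lfunP => x; rewrite comp_lfunE !lfunE /= mulrA. Qed.

Definition regmod : rmodule A :=
  @RModule K A A (@amulr K A : {linear A -> 'End(A)}) regular_act1 regular_actM.

Fact right_ideal_stable (e a x : A) :
  x \in limg (amull e) -> rmod_act regmod a x \in limg (amull e).
Proof.
case/memv_imgP => y _ ->; rewrite /= !lfunE /= -mulrA.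
by have := memv_img (amull e) (memvf (y * a)); rewrite lfunE.
Qed.

Definition right_ideal (e : A) : submodule regmod :=
  @Submodule K A regmod (limg (amull e)) (@right_ideal_stable e).

Definition eA (e : A) : rmodule A := submod (right_ideal e).

(* For f in eAe', the map e'A -> eA, x |-> f * x.                             *)
Definition eA_hom (e e' f : A) : 'Hom(eA e', eA e) :=
  linfun (vsproj (right_ideal e) \o (amull f \o vsval)).

Definition is_idempotent (e : A) : Prop := e * e = e.

Definition primitive_idem (e : A) : Prop :=
  [/\ e <> 0, is_idempotent e
    & forall e1 e2 : A, is_idempotent e1 -> is_idempotent e2 ->
        e1 * e2 = 0 -> e2 * e1 = 0 -> e = e1 + e2 -> e1 = 0 \/ e2 = 0].

Definition basic : Prop :=
  exists (n : nat) (e : 'I_n -> A),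
    [/\ forall i, primitive_idem (e i),
        forall i j, i != j -> e i * e j = 0,
        \sum_i e i = 1
      & forall i j, i != j -> ~ rmisomorphic (eA (e i)) (eA (e j))].

(* No cycle M_0 -> ... -> M_t; the values M i for i > t play no role.         *)
Definition representation_directed : Prop :=
  ~ exists (t : nat) (M : nat -> rmodule A),
    [/\ (0 < t)%N,
        forall i, (i <= t)%N -> indecomposable (M i),
        forall i, (i < t)%N -> exists f : 'Hom(M i, M i.+1),
          [/\ rmhom f, f <> 0 & ~ bijective f]
      & rmisomorphic (M 0%N) (M t)].

End Regular.

(* D = Hom_K(-, K), from right A-modules to right A^c-modules (i.e. left      *)
(* A-modules) and back: (phi.a)(x) = phi(x.a).                                *)

Section Precomposition.
Variables (K : fieldType) (V W : vectType K) (F : 'Hom(V, W)).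

Definition precomp_fun (phi : 'Hom(W, K^o)) : 'Hom(V, K^o) := (phi \o F)%VF.

Fact precomp_linear : linear precomp_fun.
Proof.
move=> k phi psi; apply/lfunP => x.
by rewrite !(comp_lfunE, add_lfunE, scale_lfunE).
Qed.
HB.instance Definition _ :=
  GRing.isLinear.Build K 'Hom(W, K^o) 'Hom(V, K^o) _ precomp_fun precomp_linear.

Definition precomp : 'Hom('Hom(W, K^o), 'Hom(V, K^o)) := linfun precomp_fun.

Lemma precompE phi x : precomp phi x = phi (F x).
Proof. by rewrite lfunE /= comp_lfunE. Qed.

End Precomposition.

Section Duality.
Variables (K : fieldType) (A : falgType K).

Section Dual.
Variable M : rmodule A.

Definition dual_act (a : oppalg A) : 'End('Hom(M, K^o)) :=
  precomp (rmod_act M a).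

Fact dual_act_linear : linear dual_act.
Proof.
move=> k a b; apply/lfunP => phi; apply/lfunP => x.
rewrite add_lfunE scale_lfunE add_lfunE scale_lfunE !precompE.
by rewrite [rmod_act M _]linearP add_lfunE scale_lfunE linearP.
Qed.
HB.instance Definition _ :=
  GRing.isLinear.Build K (oppalg A) 'End('Hom(M, K^o)) _
    dual_act dual_act_linear.

Fact dual_act1 : dual_act 1 = \1%VF.
Proof.
apply/lfunP => phi; apply/lfunP => x.
by rewrite precompE [rmod_act M _]rmod_act1 !id_lfunE.
Qed.

Fact dual_actM (a b : oppalg A) :
  dual_act (a * b) = (dual_act b \o dual_act a)%VF.
Proof.
apply/lfunP => phi; apply/lfunP => x.
by rewrite comp_lfunE !precompE [rmod_act M _](rmod_actM M b a) comp_lfunE.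
Qed.

Definition dual : rmodule (oppalg A) := RModule dual_act1 dual_actM.

End Dual.

Section DualOpp.
Variable M : rmodule (oppalg A).

Definition dual_opp_act (a : A) : 'End('Hom(M, K^o)) :=
  precomp (rmod_act M (a : oppalg A)).

Fact dual_opp_act_linear : linear dual_opp_act.
Proof.
move=> k a b; apply/lfunP => phi; apply/lfunP => x.
rewrite add_lfunE scale_lfunE add_lfunE scale_lfunE !precompE.
by rewrite [rmod_act M _](linearP (rmod_act M)) add_lfunE scale_lfunE linearP.
Qed.
HB.instance Definition _ := GRing.isLinear.Build K A 'End('Hom(M, K^o)) _
  dual_opp_act dual_opp_act_linear.

Fact dual_opp_act1 : dual_opp_act 1 = \1%VF.
Proof.
apply/lfunP => phi; apply/lfunP => x.
by rewrite precompE [rmod_act M _]rmod_act1 !id_lfunE.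
Qed.

Fact dual_opp_actM (a b : A) :
  dual_opp_act (a * b) = (dual_opp_act b \o dual_opp_act a)%VF.
Proof.
apply/lfunP => phi; apply/lfunP => x.
by rewrite comp_lfunE !precompE [rmod_act M _](rmod_actM M b a) comp_lfunE.
Qed.

Definition dual_opp : rmodule A := RModule dual_opp_act1 dual_opp_actM.

End DualOpp.

(* The right A-module D(Ae): the left ideal Ae is the right ideal generated   *)
(* by e in A^c.                                                               *)
Definition DAe (e : A) : rmodule A := dual_opp (@eA K (oppalg A) e).

(* For g in eAe', the map D(Ae') -> D(Ae) dual to Ae -> Ae', x |-> x * g.     *)
Definition DAe_hom (e e' g : A) : 'Hom(DAe e', DAe e) :=
  precomp (@eA_hom K (oppalg A) e' e g).

Definition right_abutment (I : rmodule A) : Prop :=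
  [/\ indecomposable I, injective_mod I & left_abutment (dual I)].

(* Sequences are indexed from 1, as e_1, ..., e_h; other values are ignored.  *)
Definition primitive_orthogonal (h : nat) (e : nat -> A) : Prop :=
  (forall i, (1 <= i <= h)%N -> primitive_idem (e i)) /\
  (forall i j, (1 <= i <= h)%N -> (1 <= j <= h)%N -> i <> j -> e i * e j = 0).

(* The conventional f_h = 0 : 0 -> e_hA only records that e_hA is simple.     *)
Definition left_realization (P : rmodule A) (h : nat) (e f : nat -> A) : Prop :=
  [/\ (0 < h)%N,
      primitive_orthogonal h e,
      rmisomorphic (eA (e 1%N)) P,
      simple_mod (eA (e h))
    & forall i, (1 <= i < h)%N ->
        [/\ e i * f i * e i.+1 = f i,
            lker (eA_hom (e i) (e i.+1) (f i)) = 0%VS,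
            limg (eA_hom (e i) (e i.+1) (f i)) <> fullv
          & forall U : submodule (eA (e i)),
              (limg (eA_hom (e i) (e i.+1) (f i)) <= U)%VS ->
              U = limg (eA_hom (e i) (e i.+1) (f i)) :> {vspace _} \/
              U = fullv :> {vspace _}]].

(* Dually, g_0 = 0 : D(Ae_1) -> 0 only records that D(Ae_1) is simple.        *)
Definition right_realization (I : rmodule A) (h : nat) (e g : nat -> A) :
  Prop :=
  [/\ (0 < h)%N,
      primitive_orthogonal h e,
      rmisomorphic I (DAe (e h)),
      simple_mod (DAe (e 1%N))
    & forall i, (1 <= i < h)%N ->
        [/\ e i * g i * e i.+1 = g i,
            limg (DAe_hom (e i) (e i.+1) (g i)) = fullv,
            lker (DAe_hom (e i) (e i.+1) (g i)) <> 0%VS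
          & forall U : submodule (DAe (e i.+1)),
              (U <= lker (DAe_hom (e i) (e i.+1) (g i)))%VS ->
              U = 0%VS :> {vspace _} \/
              U = lker (DAe_hom (e i) (e i.+1) (g i)) :> {vspace _}]].

End Duality.

(* The quiver 1 -> 2 -> ... -> h has exactly one path from i to j when        *)
(* i <= j, encoded by the pair (i, j), and no other paths.                    *)
Definition Apath (h : nat) : predArgType :=
  {p : 'I_h.+1 * 'I_h.+1 | (0 < p.1)%N && (p.1 <= p.2)%N}.

Definition psource h (p : Apath h) : 'I_h.+1 := (val p).1.
Definition ptarget h (p : Apath h) : 'I_h.+1 := (val p).2.

(* r is the concatenation "p then q". *)
Definition is_concat h (p q r : Apath h) : bool :=
  [&& ptarget p == psource q, psource r == psource p & ptarget r == ptarget q].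

Definition pathalg (K : fieldType) (h : nat) : Type := {ffun Apath h -> K^o}.

Section PathAlgebra.
Variables (K : fieldType) (h : nat).
Local Notation KA := (pathalg K h).
Implicit Types x y z : KA.

HB.instance Definition _ := Vector.copy KA {ffun Apath h -> K^o}.

Definition pathalg_one : KA :=
  [ffun p : Apath h => (psource p == ptarget p)%:R : K^o].

Definition pathalg_mul x y : KA :=
  [ffun r : Apath h =>
     (\sum_(p : Apath h) \sum_(q : Apath h | is_concat p q r) x p * y q) : K^o].

(* An injective, multiplicative matrix model, used only to check the axioms.  *)
Let mx x : 'M[K]_h.+1 :=
  \matrix_(i, j) \sum_(p | (psource p == i) && (ptarget p == j)) x p.

Let mx_coef x p : mx x (psource p) (ptarget p) = x p.
Proof. by rewrite mxE (big_pred1 p). Qed.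

Let mx_inj : injective mx.
Proof. by move=> x y xy; apply/ffunP => p; rewrite -!mx_coef xy. Qed.

Let mxD x y : mx (x + y) = mx x + mx y.
Proof.
apply/matrixP => i j; rewrite !mxE -big_split /=.
by apply: eq_bigr => p _; rewrite ffunE.
Qed.

Let mx1 i j : mx pathalg_one i j = ((0 < i)%N && (i == j))%:R.
Proof.
rewrite mxE; case: (boolP ((0 < i)%N && (i <= j)%N)) => [ij | nij].
  rewrite (big_pred1 (Sub (i, j) ij : Apath h)) // ffunE.
  by rewrite /psource /ptarget /=; case/andP: ij => ->.
rewrite big_pred0 => [|q].
  by case: eqP nij => [-> | _]; rewrite ?leqnn ?andbT ?andbF // => /negPf->.
apply/negP => /andP[/eqP qi /eqP qj]; case/negP: nij.
by rewrite -qi -qj; exact: (valP q).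
Qed.

Let mxM x y : mx (pathalg_mul x y) = mx x *m mx y.
Proof.
apply/matrixP => i k; rewrite !mxE.
pose c (p q : Apath h) :=
  [&& psource p == i, ptarget p == psource q & ptarget q == k].
transitivity (\sum_p \sum_(q | c p q) x p * y q).
  under eq_bigr do rewrite ffunE.
  rewrite exchange_big /=; apply: eq_bigr => p _.
  rewrite (exchange_big_dep predT) //= [RHS]big_mkcond /=.
  apply: eq_bigr => q _; case: ifP => [/and3P[pi pq qk] | cF].
    have ik : (0 < i)%N && (i <= k)%N.
      rewrite -(eqP pi) -(eqP qk); case/andP: (valP p) => -> /= pp.
      case/andP: (valP q) => _; apply: leq_trans.
      by rewrite -[leqRHS]/(nat_of_ord (psource q)) -(eqP pq).
    rewrite (big_pred1 (Sub (i, k) ik : Apath h)) // => r.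
    by rewrite /= /is_concat pq (eqP pi) (eqP qk) /= andbb.
  rewrite big1 // => r /andP[/andP[/eqP ri /eqP rk] /and3P[pq rp rq]].
  by move: cF; rewrite /c pq -(eqP rp) -(eqP rq) ri rk !eqxx.
under [RHS]eq_bigr do rewrite !mxE big_distrlr /=.
rewrite [RHS](exchange_big_dep (fun p => psource p == i)) /=; last first.
  by move=> j p _ /andP[].
rewrite [RHS]big_mkcond /=; apply: eq_bigr => p _.
case: (boolP (psource p == i)) => pi; last first.
  by rewrite big1 // => q; rewrite /c (negPf pi).
rewrite (big_pred1 (ptarget p)) => [|j]; last by rewrite /= eq_sym.
by apply: eq_bigl => q; rewrite /c pi /= eq_sym.
Qed.

Fact pathalg_mulA : associative pathalg_mul.
Proof. by move=> x y z; apply: mx_inj; rewrite !mxM mulmxA. Qed.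

Fact pathalg_mul1l : left_id pathalg_one pathalg_mul.
Proof.
move=> x; apply: mx_inj; rewrite mxM; apply/matrixP => i k.
rewrite mxE (bigD1 i) //= mx1 eqxx andbT big1 ?addr0 => [|j /negPf ji].
  case: posnP => [i0 | _]; last by rewrite mul1r.
  rewrite mul0r mxE big_pred0 // => p; apply/negP => /andP[/eqP pi _].
  by case/andP: (valP p); rewrite -[(val p).1]/(psource p) pi i0.
by rewrite mx1 eq_sym ji andbF mul0r.
Qed.

Fact pathalg_mul1r : right_id pathalg_one pathalg_mul.
Proof.
move=> x; apply: mx_inj; rewrite mxM; apply/matrixP => i k.
rewrite mxE (bigD1 k) //= mx1 eqxx andbT big1 ?addr0 => [|j /negPf jk].
  case: posnP => [k0 | _]; last by rewrite mulr1.
  rewrite mulr0 mxE big_pred0 // => p; apply/negP => /andP[_ /eqP pk].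
  case/andP: (valP p) => p0; rewrite -[(val p).2]/(ptarget p) pk k0.
  by rewrite leqNgt p0.
by rewrite mx1 jk andbF mulr0.
Qed.

Fact pathalg_mulDl : left_distributive pathalg_mul +%R.
Proof. by move=> x y z; apply: mx_inj; rewrite !(mxM, mxD) mulmxDl. Qed.

Fact pathalg_mulDr : right_distributive pathalg_mul +%R.
Proof. by move=> x y z; apply: mx_inj; rewrite !(mxM, mxD) mulmxDr. Qed.

HB.instance Definition _ := GRing.Zmodule_isPzRing.Build KA
  pathalg_mulA pathalg_mul1l pathalg_mul1r pathalg_mulDl pathalg_mulDr.

(* The basis element of the path from i to j (1 <= i <= j <= h): apath i i is *)
(* the vertex idempotent t_i and apath i i.+1 is the arrow alpha_i.           *)
Definition apath (i j : nat) : KA :=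
  [ffun p : Apath h =>
     ((psource p == i :> nat) && (ptarget p == j :> nat))%:R : K^o].

End PathAlgebra.

(* The property characterising f_P (resp. g_I) as an algebra homomorphism,    *)
(* for (e, f) the realization of P (resp. I).                                 *)
Definition realization_hom (K : fieldType) (A : falgType K) (h : nat)
    (e f : nat -> A) (F : {lrmorphism A -> pathalg K h}) : Prop :=
  [/\ F (1 - \sum_(1 <= i < h.+1) e i) = 0,
      forall i, (1 <= i <= h)%N -> F (e i) = apath K h i i
    & forall i, (1 <= i < h)%N -> F (f i) = apath K h i i.+1].

Section Gluing.
Variables (K : fieldType) (A B : falgType K) (h : nat).

HB.instance Definition _ := Vector.on (A * B)%type.
Definition prodalg : falgType K := (A * B)%type.

Variables (fP : {lrmorphism A -> pathalg K h}).
Variables (gI : {lrmorphism B -> pathalg K h}).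

Definition gluing_map (ab : prodalg) : pathalg K h := fP ab.1 - gI ab.2.

Fact gluing_map_linear : linear gluing_map.
Proof.
move=> k [a b] [a' b']; rewrite /gluing_map /= !linearP /=.
by rewrite scalerBr scalerN addrACA.
Qed.
HB.instance Definition _ :=
  GRing.isLinear.Build K prodalg (pathalg K h) _
    gluing_map gluing_map_linear.

Definition gluing_vspace : {vspace prodalg} := lker (linfun gluing_map).

Lemma memv_gluing (ab : prodalg) :
  (ab \in gluing_vspace) = (fP ab.1 == gI ab.2).
Proof. by rewrite memv_ker lfunE /= subr_eq0. Qed.

Fact gluing_is_aspace : is_aspace gluing_vspace.
Proof.
apply/andP; split.
  by apply: has_algid1; rewrite memv_gluing !rmorph1.
apply/prodvP => -[a b] [a' b']; rewrite !memv_gluing /= => /eqP ab /eqP ab'.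
by rewrite !rmorphM /= ab ab'.
Qed.

Definition gluing_aspace : {aspace prodalg} := ASpace gluing_is_aspace.

(* The algebra {(a, b) | fP a = gI b}; its unit is (1, 1).                    *)
Definition gluing : falgType K := subvs_of gluing_aspace.

End Gluing.

(* Main.v *)
From HB Require Import structures.
Require Import Defs.
From mathcomp Require Import all_boot all_order all_algebra all_field.

(** Write L for the gluing, c = 1 - sum_i e_i and c' = 1 - sum_i eps_i, and let
    J and Q be the kernels of the projections of L onto B and A, so that
    J Q = 0 and the modules killed by J (resp. Q) are exactly the B-modules
    (resp. A-modules).  Everything follows from one splitting property: for
    every L-module M, the submodule M J is a direct summand
    ([modmul_complement]).

    Over the tail 1 -> ... -> h an L-module restricts to a representation V of
    this linear quiver, and M J restricts to a subrepresentation N of it.  Since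
    P is a left abutment, a path from outside the tail of A to a vertex i of
    the tail passes through 1 ([left_abutment_factor]), so the maps
    N_1 -> N_2 -> ... -> N_h are surjective.  Such representations are injective
    over the tail, hence N has a complement in V; the complement is built from
    the vertex h back to the vertex 1 ([extend_complement]).  Together with
    M Q, it is an L-submodule, because out of a tail vertex L only offers the
    tail itself and elements of Q, and M Q meets M J trivially because J Q = 0.

    So an indecomposable M satisfies M J = 0, and is then a B-module, or
    M J = M, in which case M Q = 0 and M is an A-module
    ([indecomposable_modmul]).  In the second case a nonzero morphism M -> M'
    maps M = M J to a nonzero part of M' J, so M' is again of the second kind.
    Along a cycle of nonzero nonisomorphisms the modules are therefore all of
    the same kind, and the cycle already lives over A or over B
    ([directed_of_dichotomy]).

    The facts on A and B that this uses come from the realizations.  The maps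
    to the path algebra of the tail are injective on e_i A and on B eps_i
    ([left_tail_inj], [right_tail_inj]): the kernel cannot meet the top of e_i A
    since the radical f_i e_{i+1} A maps into the span of the nontrivial paths,
    so one descends along the composition series.  Consequently
    e_i A c = 0 = c' B eps_i, and the kernels are c A and B c'. *)

Set Implicit Arguments.
Unset Strict Implicit.
Unset Printing Implicit Defensive.

Import GRing.Theory.
Local Open Scope ring_scope.

Local Notation "x ** a" := (rmod_act _ a x) (at level 40, left associativity).

(** * Modules over a finite-dimensional algebra *)

Section ModuleFacts.
Variables (K : fieldType) (A : falgType K).
Implicit Types (M N : rmodule A) (a b : A).

Lemma act1 M (x : M) : x ** 1 = x.
Proof. by rewrite rmod_act1 id_lfunE. Qed.

Lemma actM M (x : M) a b : x ** (a * b) = x ** a ** b.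
Proof. by rewrite rmod_actM comp_lfunE. Qed.

Lemma actD M (x : M) a b : x ** (a + b) = x ** a + x ** b.
Proof. by rewrite linearD add_lfunE. Qed.

Lemma actB M (x : M) a b : x ** (a - b) = x ** a - x ** b.
Proof. by rewrite linearB add_lfunE opp_lfunE. Qed.

Lemma actZ M (x : M) k a : x ** (k *: a) = k *: (x ** a).
Proof. by rewrite linearZ scale_lfunE. Qed.

Lemma act0 M (x : M) : x ** 0 = 0.
Proof. by rewrite linear0 zero_lfunE. Qed.

Lemma act_sum M (x : M) I (r : seq I) (P : pred I) (F : I -> A) :
  x ** (\sum_(i <- r | P i) F i) = \sum_(i <- r | P i) x ** F i.
Proof. by rewrite linear_sum sum_lfunE. Qed.

Definition act_on M (x : M) (a : A) : M := x ** a.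

Fact act_on_linear M (x : M) : linear (act_on x).
Proof. by move=> k a b; rewrite /act_on actD actZ. Qed.

HB.instance Definition _ M (x : M) :=
  GRing.isLinear.Build K A M _ (act_on x) (act_on_linear x).

Definition act_map M (x : M) : 'Hom(A, M) := linfun (act_on x).

Lemma act_mapE M (x : M) a : act_map x a = x ** a.
Proof. by rewrite lfunE. Qed.

Definition stable M (U : {vspace M}) : Prop :=
  forall a x, x \in U -> x ** a \in U.

Lemma stableD M (U V : {vspace M}) : stable U -> stable V -> stable (U + V)%VS.
Proof.
move=> sU sV a _ /memv_addP[u Uu [v Vv ->]].
by rewrite linearD memv_add ?sU ?sV.
Qed.

Lemma stable_limg M N (f : 'Hom(M, N)) : rmhom f -> stable (limg f).
Proof. by move=> fM a _ /memv_imgP[x _ ->]; rewrite -fM memv_img ?memvf. Qed.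

Lemma rmhom_inv M N (f : 'Hom(M, N)) : rmhom f -> bijective f ->
  exists g : 'Hom(N, M), [/\ rmhom g, cancel f g & cancel g f].
Proof.
move=> fM bf; have f0 : lker f == 0%VS by apply/lker0P/bij_inj.
have fK := lker0_lfunK f0.
have fVK : cancel (f^-1)%VF f.
  move=> y; have [g gf fg] := bf; apply: limg_lfunVK.
  by rewrite -[y]fg memv_img ?memvf.
by exists (f^-1)%VF; split=> // a y; rewrite -{1}[y]fVK -fM fK.
Qed.

Lemma indecomposableP M (U V : {vspace M}) :
  indecomposable M -> stable U -> stable V ->
  (U + V)%VS = fullv -> (U :&: V)%VS = 0%VS -> U = 0%VS \/ V = 0%VS.
Proof.
by case=> _ iM sU sV; apply: iM (Submodule sU) (Submodule sV).
Qed.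

(** The span of the products of M and S; a basis of S suffices and keeps the
    sum finite. *)
Definition modmul M (S : {vspace A}) : {vspace M} :=
  (\sum_(i < \dim S) limg (rmod_act M (vbasis S)`_i))%VS.

Lemma mem_modmul M (S : {vspace A}) (x : M) a :
  a \in S -> x ** a \in modmul M S.
Proof.
move=> Sa; rewrite (coord_vbasis Sa) act_sum memv_suml // => i _.
rewrite actZ memvZ //; apply: subvP (sumv_sup i _ (subvv _)) _ _ => //.
by rewrite memv_img ?memvf.
Qed.

Lemma modmul_sub M (S : {vspace A}) (W : {vspace M}) :
  (forall x a, a \in S -> x ** a \in W) -> (modmul M S <= W)%VS.
Proof.
move=> SW; apply/subv_sumP => i _; apply/subvP => _ /memv_imgP[x _ ->].
by apply: SW; rewrite vbasis_mem // mem_nth // size_tuple.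
Qed.

Lemma modmul_stable M (S : {vspace A}) :
  (forall a b, a \in S -> a * b \in S) -> stable (modmul M S).
Proof.
move=> SA b x Sx; rewrite memv_preim; apply: subvP Sx.
apply: modmul_sub => y a Sa.
by rewrite -memv_preim -actM mem_modmul ?SA.
Qed.

Lemma modmul_hom M N (f : 'Hom(M, N)) (S : {vspace A}) x :
  rmhom f -> x \in modmul M S -> f x \in modmul N S.
Proof.
move=> fM Sx; rewrite memv_preim; apply: subvP Sx; apply: modmul_sub => y a Sa.
by rewrite -memv_preim fM mem_modmul.
Qed.

End ModuleFacts.

(** * Splitting off the submodule M J *)

(** The situation of the gluing, reduced to what the splitting uses: [E i] and
    [al i] are the tail idempotents and arrows, J collects the elements that
    start outside the tail on the side of A, and Q those that end outside the
    tail on the side of B.  [tail] expresses that the tail is linear and that no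
    path of A leaves it, and [J_tail] is where the abutment property of P
    enters.  Setting [al h = 0] lets the last vertex be treated like the
    others. *)
Section Splitting.
Variables (K : fieldType) (R : falgType K) (J Q : {vspace R}).
Variables (h : nat) (E al : nat -> R) (eQ : R).
Hypothesis J_ideal : forall a b, a \in J -> a * b \in J.
Hypothesis Q_ideal : forall a b, a \in Q -> a * b \in Q.
Hypothesis JQ0 : forall a b, a \in J -> b \in Q -> a * b = 0.
Hypothesis QeQ : forall b, b \in Q -> b * eQ = b.
Hypothesis eQ_Q : eQ \in Q.
Hypothesis E_idem : forall i, (1 <= i <= h)%N -> E i * E i = E i.
Hypothesis E1 : 1 - \sum_(1 <= i < h.+1) E i \in (J + Q)%VS.
Hypothesis Eal : forall i, (1 <= i < h)%N -> E i * al i = al i.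
Hypothesis alE : forall i, (1 <= i < h)%N -> al i * E i.+1 = al i.
Hypothesis al_h : al h = 0.
Hypothesis tail : forall i a, (1 <= i <= h)%N ->
  exists c b, E i * a - (c *: E i + al i * b) \in Q.
Hypothesis J_tail : forall i a, (1 <= i < h)%N -> a \in J ->
  exists2 b, b \in J & a * E i.+1 = b * al i.

Variable M : rmodule R.
Let N := modmul M J.
Let L := modmul M Q.

Let N_stable : stable N. Proof. exact: modmul_stable. Qed.
Let L_stable : stable L. Proof. exact: modmul_stable. Qed.

Let NeQ x : x \in N -> x ** eQ = 0.
Proof.
move=> Nx; apply/eqP; rewrite -memv_ker; apply: subvP Nx.
apply: modmul_sub => y a Ja.
by rewrite memv_ker -actM JQ0 ?act0.
Qed.

Let LeQ x : x \in L -> x ** eQ = x.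
Proof.
move=> Lx; suff: x ** (eQ - 1) == 0 by rewrite actB act1 subr_eq0 => /eqP.
rewrite -memv_ker; apply: subvP Lx; apply: modmul_sub => y a Qa.
by rewrite memv_ker -actM mulrBr mulr1 QeQ // subrr act0.
Qed.

(** The surjectivity of N_i -> N_{i+1}. *)
Lemma modmul_tail i x : (1 <= i < h)%N -> x \in N ->
  exists2 y, y \in N & x ** E i.+1 = y ** al i.
Proof.
move=> hi Nx.
suff /memv_imgP[y Ny ->]: x ** E i.+1 \in (rmod_act M (al i) @: N)%VS.
  by exists y.
rewrite memv_preim; apply: subvP Nx; apply: modmul_sub => y a Ja.
have [b Jb aE] := J_tail hi Ja.
by rewrite -memv_preim -actM aE actM memv_img ?mem_modmul.
Qed.

(** One step of the injectivity argument for N.  A vector v at i whose image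
    under [al i] is n + c, with n in N and c in C, can be corrected by a
    preimage of n in N, after which [al i] sends it into C.  Hence the
    vectors at i that [al i] sends into C, together with N and C, exhaust
    V_i, and a complement D of N + C among them keeps the sum with N direct. *)
Lemma extend_complement i (C : {vspace M}) :
  (1 <= i <= h)%N -> stable C -> (C :&: N)%VS = 0%VS -> (L <= C)%VS ->
  ((i < h)%N -> forall v : M, v ** E i.+1 \in (N + C)%VS) ->
  exists C' : {vspace M}, [/\ stable C', (C' :&: N)%VS = 0%VS, (C <= C')%VS
    & forall v : M, v ** E i \in (N + C')%VS].
Proof.
move=> hi sC CN LC next.
pose X := (limg (rmod_act M (E i)) :&: (rmod_act M (al i) @^-1: C))%VS.
pose D := (X :\: (N + C))%VS.
have DX : (D <= X)%VS by exact: diffvSl.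
exists (C + D)%VS; split; last 2 first.
- exact: addvSl.
- move=> v; have [n Nn vn] : exists2 n, n \in N & v ** al i - n ** al i \in C.
    case/andP: (hi) => i0; rewrite leq_eqVlt => /predU1P[->|ih].
      by exists 0; rewrite ?mem0v // al_h !act0 subrr mem0v.
    have hi' : (1 <= i < h)%N by rewrite i0.
    have /memv_addP[n Nn [c Cc vE]] := next ih (v ** al i).
    have [m Nm nE] := modmul_tail hi' Nn.
    have -> : v ** al i = (n + c) ** E i.+1.
      by rewrite -vE -!actM mulrA !alE.
    by exists m => //; rewrite -nE linearD /= addrC addKr sC.
  have Xv : (v - n) ** E i \in X.
    rewrite memv_cap memv_img ?memvf //= -memv_preim -actM.
    case/andP: (hi) => i0; rewrite leq_eqVlt => /predU1P[ih|ih].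
      by rewrite ih al_h mulr0 act0 mem0v.
    by rewrite Eal ?i0 // linearB.
  have : (v - n) ** E i \in (N + C + D)%VS.
    apply: subvP Xv; rewrite addvC /D addv_diff; exact: addvSl.
  rewrite addvA => vS; have -> : v ** E i = (v - n) ** E i + n ** E i.
    by rewrite -linearD subrK.
  by rewrite memvD // -addvA (subvP (addvSl _ _)) // N_stable.
- move=> b x /memv_addP[c Cc [d Dd ->]]; rewrite linearD /=.
  rewrite memvD ?(subvP (addvSl _ _) _ (sC _ _ Cc)) //.
  have := subvP DX _ Dd; rewrite memv_cap => /andP[/memv_imgP[y _ dE]].
  rewrite -memv_preim => dC.
  have dEi : d ** E i = d by rewrite dE -actM E_idem.
  have [k [b' /(mem_modmul d)]] := tail b hi.
  rewrite actB actM dEi actD actZ dEi actM => /(subvP LC) lC.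
  rewrite -(subrK (k *: d + d ** al i ** b') (d ** b)) memvD //.
    exact: subvP (addvSl _ _) _ lC.
  by rewrite addrC memv_add ?memvZ ?(sC b' _ dC).
- apply/eqP; rewrite -subv0; apply/subvP => x.
  rewrite memv_cap => /andP[/memv_addP[c Cc [d Dd ->]] Nx].
  have d0 : d = 0.
    apply/eqP; rewrite -memv0 -(capv_diff X (N + C)%VS) memv_cap Dd.
    by rewrite -(addKr c d) addrC memv_add ?memvN.
  by move: Nx; rewrite d0 addr0 -CN memv_cap Cc.
Qed.

Lemma modmul_complement :
  exists C : {vspace M}, [/\ stable C, (C :&: N)%VS = 0%VS, (L <= C)%VS
    & (C + N)%VS = fullv].
Proof.
have LN : (L :&: N)%VS = 0%VS.
  apply/eqP; rewrite -subv0; apply/subvP => x.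
  by rewrite memv_cap memv0 => /andP[Lx Nx]; rewrite -(LeQ Lx) NeQ.
have [C [sC CN LC tailC]] : exists C : {vspace M},
    [/\ stable C, (C :&: N)%VS = 0%VS, (L <= C)%VS
    & forall i, (1 <= i <= h)%N -> forall v : M, v ** E i \in (N + C)%VS].
  suff /(_ h (leqnn h))[C [sC CN LC tailC]] : forall k, (k <= h)%N ->
      exists C : {vspace M}, [/\ stable C, (C :&: N)%VS = 0%VS, (L <= C)%VS
        & forall i, (h - k < i <= h)%N ->
            forall v : M, v ** E i \in (N + C)%VS].
    by exists C; split=> // i; rewrite -(subnn h); apply: tailC.
  elim=> [|k IHk] kh.
    by exists L; split=> // i; rewrite subn0 ltnNge andNb.
  have [C [sC CN LC tailC]] := IHk (ltnW kh).
  have hk : (1 <= h - k <= h)%N by rewrite subn_gt0 kh leq_subr.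
  have [|C' [sC' CN' CC' headC]] := extend_complement hk sC CN LC.
    by move=> ih; apply: tailC; rewrite ltnSn.
  exists C'; split=> // [|i /andP[]]; first exact: subv_trans CC'.
  rewrite subnS prednK ?subn_gt0 // leq_eqVlt => /predU1P[<-|ki] ih v //.
  by apply: subvP (addvS (subvv N) CC') _ _; rewrite tailC ?ki.
exists C; split=> //; apply/vspaceP => v; rewrite memvf addvC.
rewrite -[v]act1 -(subrK (\sum_(1 <= i < h.+1) E i) 1) actD memvD //.
  have /memv_addP[a Ja [b Qb ->]] := E1; rewrite actD memv_add ?mem_modmul //.
  by rewrite (subvP LC) ?mem_modmul.
by rewrite act_sum big_nat memv_suml // => i hi; apply: tailC.
Qed.

Lemma indecomposable_modmul :
  indecomposable M ->
  modmul M J = 0%VS \/ modmul M J = fullv /\ modmul M Q = 0%VS.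
Proof.
move=> iM; have [C [sC CN LC CNf]] := modmul_complement.
have [C0 | N0] := indecomposableP iM sC N_stable CNf CN; last by left.
right; split; first by rewrite -CNf C0 add0v.
by apply/eqP; rewrite -subv0 -C0.
Qed.

End Splitting.

(** * The path algebra of the linear quiver *)

Section PathAlgebraFacts.
Variables (K : fieldType) (h : nat).
Local Notation KA := (pathalg K h).
Implicit Types (x y : KA) (p q r : Apath h).
Local Notation ap := (@apath K h).

Lemma pathalgE x y r :
  (x * y) r = \sum_(p : Apath h) \sum_(q : Apath h | is_concat p q r) x p * y q.
Proof. by rewrite [LHS]ffunE. Qed.

Lemma path_scaleAl k x y : (k *: x) * y = k *: (x * y).
Proof.
apply/ffunP => r; rewrite [RHS]ffunE !pathalgE [RHS]scaler_sumr.
apply: eq_bigr => p _; rewrite [RHS]scaler_sumr; apply: eq_bigr => q _.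
by rewrite ffunE -[RHS]/(k * _) mulrA.
Qed.

Lemma path_scaleAr k x y : x * (k *: y) = k *: (x * y).
Proof.
apply/ffunP => r; rewrite [RHS]ffunE !pathalgE [RHS]scaler_sumr.
apply: eq_bigr => p _; rewrite [RHS]scaler_sumr; apply: eq_bigr => q _.
by rewrite ffunE -[RHS]/(k * _) mulrCA.
Qed.

Lemma apathE i j p :
  ap i j p = ((psource p == i :> nat) && (ptarget p == j :> nat))%:R.
Proof. by rewrite ffunE. Qed.

Lemma apath_expand x :
  x = \sum_p x p *: ap (psource p) (ptarget p).
Proof.
apply/ffunP => r; rewrite sum_ffunE (bigD1 r) //= big1 => [|p pr].
  by rewrite ffunE apathE !eqxx addr0 -[RHS]/(_ * _) mulr1.
rewrite ffunE apathE; case: eqP => [s|]; last by rewrite scaler0.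
case: eqP => [t|]; last by rewrite scaler0.
case/eqP: pr; apply: val_inj; rewrite [val p]surjective_pairing.
rewrite [val r]surjective_pairing; congr pair; exact: ord_inj.
Qed.

Lemma psource_gt0 p : (0 < psource p)%N. Proof. by case/andP: (valP p). Qed.
Lemma ptarget_ge p : (psource p <= ptarget p)%N.
Proof. by case/andP: (valP p). Qed.

Lemma mk_path i j : (0 < i)%N -> (i <= j)%N -> (j <= h)%N ->
  {p : Apath h | psource p = i :> nat & ptarget p = j :> nat}.
Proof.
move=> i0 ij jh; have ih := leq_trans ij jh.
pose u : 'I_h.+1 * 'I_h.+1 := (inord i, inord j).
have u_path : (0 < u.1)%N && (u.1 <= u.2)%N by rewrite /= !inordK ?i0.
by exists (Sub u u_path); rewrite /psource /ptarget /= inordK.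
Qed.

Lemma path_inj p q :
  psource p = psource q :> nat -> ptarget p = ptarget q :> nat -> p = q.
Proof.
move=> s t; apply: val_inj; rewrite [val p]surjective_pairing.
by rewrite [val q]surjective_pairing; congr pair; apply: ord_inj.
Qed.

Lemma apathM_neq i j k l : j != k -> ap i j * ap k l = 0.
Proof.
move=> jk; apply/ffunP => r; rewrite pathalgE ffunE big1 // => p _.
rewrite big1 // => q /and3P[/eqP pq _ _]; rewrite !apathE.
case: eqP => [_|]; last by rewrite mul0r.
case: eqP => [pj|]; last by rewrite mul0r.
case: eqP => [qk|]; last by rewrite mulr0.
by case/eqP: jk; rewrite -pj -qk pq.
Qed.

Lemma apathM i j l : (0 < i)%N -> (i <= j <= l)%N -> (l <= h)%N ->
  ap i j * ap j l = ap i l.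
Proof.
move=> i0 /andP[ij jl] lh; have il := leq_trans ij jl.
have [p pi pj] := mk_path i0 ij (leq_trans jl lh).
have [q qj ql] := mk_path (leq_trans i0 ij) jl lh.
apply/ffunP => r; rewrite pathalgE (bigD1 p) //= [X in _ + X]big1 => [|p' p'p].
  rewrite big_mkcond (bigD1 q) //= [X in _ + X + _]big1 => [|q' q'q].
    rewrite !addr0 !apathE pi pj qj ql !eqxx mulr1 /is_concat -!val_eqE /=.
    by rewrite pi pj qj ql eqxx /=; case: (_ && _).
  case: ifP => // _; rewrite !apathE.
  case: (psource q' =P j :> nat) => [qj'|]; last by rewrite mulr0.
  case: (ptarget q' =P l :> nat) => [ql'|]; last by rewrite mulr0.
  by case/eqP: q'q; apply: path_inj; rewrite ?qj' ?ql'.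
rewrite big1 // => q' _; rewrite !apathE.
case: eqP => [pi'|]; last by rewrite mul0r.
case: eqP => [pj'|]; last by rewrite mul0r.
by case/eqP: p'p; apply: path_inj; rewrite ?pi' ?pj'.
Qed.

Lemma apath_neq0 i j : (0 < i)%N -> (i <= j <= h)%N -> ap i j != 0.
Proof.
move=> i0 /andP[ij jh]; have [p pi pj] := mk_path i0 ij jh.
apply/eqP => /ffunP/(_ p)/eqP; rewrite apathE ffunE pi pj !eqxx.
by rewrite oner_eq0.
Qed.

Lemma apath_mull i j x : (0 < i)%N -> (i <= j)%N ->
  ap i j * x = \sum_(p | psource p == j :> nat) x p *: ap i (ptarget p).
Proof.
move=> i0 ij; rewrite {1}[x]apath_expand mulr_sumr [RHS]big_mkcond /=.
apply: eq_bigr => p _; rewrite path_scaleAr; case: eqP => [pj|/eqP pj].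
  by rewrite pj apathM ?leq_ord // ij -pj ptarget_ge.
by rewrite apathM_neq 1?eq_sym // scaler0.
Qed.

Lemma apath_mulr i j x : (i <= j)%N -> (j <= h)%N ->
  x * ap i j = \sum_(p | ptarget p == i :> nat) x p *: ap (psource p) j.
Proof.
move=> ij jh; rewrite {1}[x]apath_expand mulr_suml [RHS]big_mkcond /=.
apply: eq_bigr => p _; rewrite path_scaleAl; case: eqP => [pi|/eqP pi].
  by rewrite pi apathM // ?psource_gt0 // ?ij -?pi ?ptarget_ge.
by rewrite apathM_neq // scaler0.
Qed.

(** Prolonging paths to the left is injective: distinct paths from j give
    distinct paths from i. *)
Lemma apath_mull_eq0 i j x : (0 < i)%N -> (i <= j)%N ->
  ap i j * x = 0 -> ap j j * x = 0.
Proof.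
move=> i0 ij; have j0 := leq_trans i0 ij; rewrite !apath_mull // => x0.
apply: big1 => p /eqP pj; have ptgt := ptarget_ge p.
have it : (i <= ptarget p)%N by rewrite (leq_trans ij) // -pj.
have [q qi qt] := mk_path i0 it (leq_ord (ptarget p)).
have /ffunP/(_ q) := x0; rewrite sum_ffunE ffunE (bigD1 p) ?pj //= big1.
  rewrite ffunE apathE qi qt !eqxx addr0 -[LHS]/(_ * _) mulr1 => ->.
  by rewrite scale0r.
move=> p' /andP[/eqP p'j p'p]; rewrite ffunE apathE.
case: eqP => [_|]; last by rewrite scaler0.
case: (_ =P _) => [e|]; last by rewrite scaler0.
by case/eqP: p'p; apply: path_inj; rewrite ?p'j -?e.
Qed.

Lemma apath_mulr_eq0 i j x : (i <= j)%N -> (j <= h)%N ->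
  x * ap i j = 0 -> x * ap i i = 0.
Proof.
move=> ij jh; have ih := leq_trans ij jh; rewrite !apath_mulr // => x0.
apply: big1 => p /eqP pi; have psrc := ptarget_ge p.
have sj : (psource p <= j)%N by rewrite (leq_trans psrc) // pi.
have [q qs qj] := mk_path (psource_gt0 p) sj jh.
have /ffunP/(_ q) := x0; rewrite sum_ffunE ffunE (bigD1 p) ?pi //= big1.
  rewrite ffunE apathE qs qj !eqxx addr0 -[LHS]/(_ * _) mulr1 => ->.
  by rewrite scale0r.
move=> p' /andP[/eqP p'i p'p]; rewrite ffunE apathE.
case: eqP => [e|]; last by rewrite scaler0.
by case/eqP: p'p; apply: path_inj; rewrite ?p'i ?pi // -e.
Qed.

(** There is no path from l back to an earlier vertex i. *)
Lemma apath_triangular i l x :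
  (0 < i)%N -> (i < l <= h)%N -> ap l l * x * ap i i = 0.
Proof.
move=> i0 /andP[il lh]; rewrite apath_mull ?(leq_trans i0 (ltnW il)) //.
rewrite mulr_suml big1 // => p /eqP pl.
rewrite path_scaleAl apathM_neq ?scaler0 //.
by rewrite neq_ltn (leq_trans il) ?orbT // -pl ptarget_ge.
Qed.

(** A path starting at i is trivial or begins with the arrow out of i. *)
Lemma apath_head i x : (0 < i)%N ->
  exists c y, ap i i * x = c *: ap i i + ap i i.+1 * y.
Proof.
move=> i0; rewrite apath_mull //.
exists (\sum_(p | (psource p == i :> nat) && (ptarget p == i :> nat)) x p).
exists (\sum_(p | (psource p == i :> nat) && (ptarget p != i :> nat))
          x p *: ap i.+1 (ptarget p)).
rewrite (bigID (fun p => ptarget p == i :> nat)) /=; congr (_ + _).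
  by rewrite scaler_suml; apply: eq_bigr => p /andP[_ /eqP->].
rewrite mulr_sumr; apply: eq_bigr => p /andP[/eqP ps pt]; rewrite path_scaleAr.
have it : (i < ptarget p)%N by rewrite ltn_neqAle eq_sym pt -ps ptarget_ge.
by rewrite apathM ?leqnSn ?leq_ord.
Qed.

End PathAlgebraFacts.

(** * Right ideals generated by an idempotent *)

Section RightIdeals.
Variables (K : fieldType) (A : falgType K).
Implicit Types (a b c : A).

Definition incl (M : rmodule A) (U : submodule M) : 'Hom(submod U, M) :=
  linfun vsval.

Lemma inclE (M : rmodule A) (U : submodule M) (x : submod U) :
  incl U x = vsval x.
Proof. exact: lfunE. Qed.

Lemma eA_act (c : A) (x : eA c) a : vsval (x ** a) = vsval x * a.
Proof. by rewrite sub_actE /= lfunE. Qed.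

Lemma eA_idem (c : A) (x : eA c) : is_idempotent c -> c * vsval x = vsval x.
Proof.
move=> cc; case/memv_imgP: (subvsP x) => y _ ->.
by rewrite lfunE /= mulrA cc.
Qed.

Definition eA_elt (c a : A) : eA c := vsproj (right_ideal c) (c * a).

Lemma eA_eltE c a : vsval (eA_elt c a) = c * a.
Proof.
rewrite /eA_elt vsprojK //; apply/memv_imgP; exists a; rewrite ?memvf //.
by rewrite lfunE.
Qed.

Lemma eA_hom_val (c c' f : A) (x : eA c') :
  c * f = f -> vsval (eA_hom c c' f x) = f * vsval x.
Proof.
move=> cf; rewrite lfunE /= vsprojK lfunE //= -cf -mulrA; apply/memv_imgP.
by exists (f * vsval x); rewrite ?memvf // lfunE.
Qed.

Lemma eA_hom_rmhom (c c' f : A) : c * f = f -> rmhom (eA_hom c c' f).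
Proof.
move=> cf a x; apply: subvs_inj.
by rewrite eA_hom_val // !eA_act eA_hom_val // mulrA.
Qed.

Lemma projective_eA c : is_idempotent c -> projective_mod (eA c).
Proof.
move=> cc M N p f pM pf fM.
pose u := eA_elt c 1.
have /memv_imgP[m _ mE] : f u \in limg p by rewrite pf memvf.
exists (act_map m \o incl (right_ideal c))%VF; split.
  by move=> a x; rewrite !comp_lfunE !act_mapE -actM !inclE eA_act.
apply/lfunP => x; rewrite !comp_lfunE act_mapE inclE pM -mE -fM; congr (f _).
by apply: subvs_inj; rewrite eA_act eA_eltE mulr1 eA_idem.
Qed.

(** The components of the generator c along a decomposition of cA are
    orthogonal idempotents with sum c. *)
Lemma indecomposable_eA c : primitive_idem c -> indecomposable (eA c).
Proof.
case=> c0 cc cP; pose u := eA_elt c 1.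
have uE : vsval u = c by rewrite eA_eltE mulr1.
have genu (x : eA c) : x = u ** vsval x.
  by apply: subvs_inj; rewrite eA_act uE eA_idem.
split=> [f0 | U V UV UV0].
  have : u \in fullv by rewrite memvf.
  by rewrite f0 memv0 => /eqP u0; case: c0; rewrite -uE u0.
have /memv_addP[x Ux [y Vy uxy]] : u \in (U + V)%VS by rewrite UV memvf.
have inter z : z \in U -> z \in V -> z = 0.
  by move=> Uz Vz; apply/eqP; rewrite -memv0 -UV0 memv_cap Uz.
(* x and y act as the two projections: split z = u z along U and V. *)
have decomp z : z = x ** vsval z + y ** vsval z.
  by rewrite {1}[z]genu uxy linearD.
have xz z : z \in U -> x ** vsval z = z /\ y ** vsval z = 0.
  move=> Uz; have e : y ** vsval z = 0.
    apply: inter; last exact: sub_stable.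
    rewrite -[y ** _](addKr (x ** vsval z)) -decomp memvD ?memvN //.
    exact: sub_stable.
  by split=> //; rewrite {2}[z]decomp e addr0.
have yz z : z \in V -> y ** vsval z = z /\ x ** vsval z = 0.
  move=> Vz; have e : x ** vsval z = 0.
    apply: inter; first exact: sub_stable.
    rewrite -[x ** _](addrK (y ** vsval z)) -decomp memvB //.
    exact: sub_stable.
  by split=> //; rewrite {2}[z]decomp e add0r.
have valM (z t : eA c) : vsval z * vsval t = vsval (z ** vsval t).
  by rewrite eA_act.
have killU : y = 0 -> V = 0%VS :> {vspace _}.
  move=> y0; apply/eqP; rewrite -subv0; apply/subvP => z /yz[<- _].
  by rewrite y0 linear0 mem0v.
have killV : x = 0 -> U = 0%VS :> {vspace _}.
  move=> x0; apply/eqP; rewrite -subv0; apply/subvP => z /xz[<- _].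
  by rewrite x0 linear0 mem0v.
case: (cP (vsval x) (vsval y)).
- by rewrite /is_idempotent valM (xz x Ux).1.
- by rewrite /is_idempotent valM (yz y Vy).1.
- by rewrite valM (yz y Vy).2.
- by rewrite valM (xz x Ux).2.
- by apply: etrans (esym uE) _; rewrite uxy linearD.
- by move=> x0; left; apply: killV; apply: subvs_inj; rewrite x0.
- by move=> y0; right; apply: killU; apply: subvs_inj; rewrite y0.
Qed.

(** This lemma and the next one compute c A meet W for a right ideal W along a
    composition series, here at its simple end. *)
Lemma ker_simple_eA (W : {vspace A}) c : is_idempotent c ->
  (forall a b, a \in W -> a * b \in W) ->
  (forall U : submodule (eA c),
     U = 0%VS :> {vspace _} \/ U = fullv :> {vspace _}) ->
  c \notin W -> forall a, c * a \in W -> c * a = 0.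
Proof.
move=> cc sW simp cW a ca.
pose U : {vspace eA c} := (incl (right_ideal c) @^-1: W)%VS.
have sU : forall a x, x \in U -> rmod_act (eA c) a x \in U.
  by move=> b x; rewrite -!memv_preim !inclE => Wx; rewrite eA_act sW.
have mU b : (eA_elt c b \in U) = (c * b \in W).
  by rewrite -memv_preim inclE eA_eltE.
case: (simp (Submodule sU)) => /= UE.
  have : eA_elt c a \in U by rewrite mU.
  by rewrite UE memv0 -eA_eltE => /eqP->.
by case/negP: cW; rewrite -[c]mulr1 -mU UE memvf.
Qed.

(** If f c' A is maximal in c A and c is not in W + f c' A, then W + f c' A is
    not all of c A, so it is f c' A: the elements of W in c A lie one step down
    the composition series. *)
Lemma ker_step_eA (W : {vspace A}) c c' f : is_idempotent c ->
  (forall a b, a \in W -> a * b \in W) -> c * f = f ->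
  (forall U : submodule (eA c), (limg (eA_hom c c' f) <= U)%VS ->
     U = limg (eA_hom c c' f) :> {vspace _} \/ U = fullv :> {vspace _}) ->
  (forall a, c - f * a \notin W) ->
  forall a, c * a \in W -> exists b, c * a = f * (c' * b).
Proof.
move=> cc sW cf max nW a ca.
pose V := limg (eA_hom c c' f).
pose U : {vspace eA c} := (incl (right_ideal c) @^-1: W)%VS.
have sU : stable (U + V)%VS.
  apply: stableD; last exact: stable_limg (eA_hom_rmhom cf).
  by move=> b x; rewrite -!memv_preim !inclE => Wx; rewrite eA_act sW.
have mU b : (eA_elt c b \in U) = (c * b \in W).
  by rewrite -memv_preim inclE eA_eltE.
have VE x : x \in V -> exists b, vsval x = f * (c' * b).
  case/memv_imgP=> y _ ->; rewrite eA_hom_val //.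
  by case/memv_imgP: (subvsP y) => b _ ->; exists b; rewrite lfunE.
case: (max (Submodule sU) (addvSr _ _)) => /= UE.
  have : eA_elt c a \in V by rewrite /V -UE (subvP (addvSl _ _)) ?mU.
  by case/VE=> b aE; exists b; rewrite -aE eA_eltE.
have : eA_elt c 1 \in (U + V)%VS by rewrite UE memvf.
case/memv_addP=> x Ux [y /VE[b yE] xy].
have cE : c = vsval x + vsval y.
  by rewrite -[LHS]mulr1 -eA_eltE xy linearD.
case/negP: (nW (c' * b)); suff -> : c - f * (c' * b) = vsval x.
  by move: Ux; rewrite -memv_preim inclE.
by apply/eqP; rewrite subr_eq -yE -cE.
Qed.

End RightIdeals.

(** * Annihilators in the dual module *)

Section Duals.
Variables (K : fieldType) (A : falgType K).

Lemma separate (W : vectType K) (U : {vspace W}) w : w \notin U ->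
  exists2 phi : 'Hom(W, K^o), (phi \o projv U)%VF = 0 & phi w != 0.
Proof.
move=> Uw; pose v := w - projv U w.
have v0 : v != 0.
  by apply: contraNneq Uw => /eqP; rewrite subr_eq0 => /eqP->; apply: memv_proj.
have [i vi] : exists i, coord (vbasis fullv) i v != 0.
  apply/existsP; apply: contraNT v0 => /existsPn v0.
  rewrite (coord_vbasis (memvf v)); apply/eqP; apply: big1 => i _.
  by rewrite (eqP (negbNE (v0 i))) scale0r.
pose phi : 'Hom(W, K^o) :=
  (linfun (coord (vbasis fullv) i : W -> K^o) \o (\1 - projv U))%VF.
exists phi.
  apply/lfunP => x; rewrite !comp_lfunE add_lfunE opp_lfunE id_lfunE projv_proj.
  by rewrite subrr linear0 zero_lfunE.
by rewrite comp_lfunE add_lfunE opp_lfunE id_lfunE lfunE.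
Qed.

Variables (M : rmodule (oppalg A)) (U : {vspace M}).

(** Encoded through [projv U] so as to be the kernel of a linear map. *)
Definition annihilator : {vspace dual_opp M} := lker (precomp (projv U)).

Lemma annihilatorP (phi : dual_opp M) :
  reflect (forall x, x \in U -> (phi : 'Hom(M, K^o)) x = 0)
          (phi \in annihilator).
Proof.
rewrite memv_ker; apply: (iffP eqP) => [/lfunP phi0 x Ux | phi0].
  by have := phi0 x; rewrite precompE zero_lfunE projv_id.
by apply/lfunP => x; rewrite precompE zero_lfunE phi0 ?memv_proj.
Qed.

Lemma annihilator_stable : stable U -> stable annihilator.
Proof.
move=> sU a phi /annihilatorP phi0; apply/annihilatorP => x Ux.
by rewrite /= precompE phi0 // sU.
Qed.

Lemma annihilator_separates (w : M) : w \notin U ->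
  exists2 phi : 'Hom(M, K^o), phi \in annihilator & phi w != 0.
Proof.
case/separate=> phi phiU phiw; exists phi => //; apply/annihilatorP => x Ux.
by rewrite -(projv_id Ux) -comp_lfunE phiU zero_lfunE.
Qed.

End Duals.

Section DualChains.
Variables (K : fieldType) (A : falgType K) (M : rmodule (oppalg A)).

Lemma annihilator_eq0 (U : {vspace M}) : annihilator U = 0%VS -> U = fullv.
Proof.
move=> U0; apply/vspaceP => x; rewrite memvf; apply/negbNE/negP.
case/annihilator_separates=> phi; rewrite U0 memv0 => /eqP-> /eqP[].
by rewrite zero_lfunE.
Qed.

(** Taking annihilators reverses the inclusions of submodules.  With this, the
    conditions that a right realization imposes on the modules D(B eps_i) become
    conditions on the left ideals B eps_i. *)
Lemma simple_of_dual : simple_mod (dual_opp M) ->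
  forall U : submodule M, U = 0%VS :> {vspace M} \/ U = fullv :> {vspace M}.
Proof.
case=> _ simp U; have sU := annihilator_stable (@sub_stable _ _ _ U).
case: (simp (Submodule sU)) => /= [/annihilator_eq0|Uf]; [by right | left].
apply/eqP; rewrite -subv0; apply/subvP => x Ux; apply/negbNE/negP.
case/(@annihilator_separates K A)=> phi _ /eqP[].
suff /annihilatorP-> : (phi : dual_opp M) \in annihilator U by [].
by rewrite Uf memvf.
Qed.

Lemma maximal_of_dual (M' : vectType K) (F : 'Hom(M', M)) :
  (forall U : submodule (dual_opp M), (U <= lker (precomp F))%VS ->
     U = 0%VS :> {vspace _} \/ U = lker (precomp F) :> {vspace _}) ->
  forall U : submodule M, (limg F <= U)%VS ->
    U = limg F :> {vspace M} \/ U = fullv :> {vspace M}.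
Proof.
move=> max U FU; have sU := annihilator_stable (@sub_stable _ _ _ U).
case: (max (Submodule sU)) => /= [||UF].
- apply/subvP => phi /annihilatorP phi0; rewrite memv_ker; apply/eqP/lfunP => x.
  by rewrite precompE zero_lfunE phi0 // (subvP FU) ?memv_img ?memvf.
- by move/annihilator_eq0; right.
left; apply/eqP; rewrite eqEsubv FU andbT; apply/subvP => x Ux.
apply/negbNE/negP.
case/(@annihilator_separates K A)=> phi /annihilatorP phi0 /eqP[].
suff /annihilatorP-> : (phi : dual_opp M) \in annihilator U by [].
rewrite UF memv_ker; apply/eqP/lfunP => y.
by rewrite precompE zero_lfunE phi0 ?memv_img ?memvf.
Qed.

End DualChains.

(** * The tails of A and of B *)

Section PathAlgebraHom.
Variables (K : fieldType) (A : falgType K) (h : nat) (e f : nat -> A).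
Variable F : {lrmorphism A -> pathalg K h}.
Hypothesis hF : realization_hom e f F.

(** The paths, being products of the t_i and of the arrows, are in the image. *)
Lemma realization_surj y : exists a, F a = y.
Proof.
have img a : F a \in limg (linfun F) by rewrite -(lfunE F a) memv_img ?memvf.
suff /memv_imgP[a _ ->] : y \in limg (linfun F) by exists a; rewrite lfunE.
rewrite [y]apath_expand memv_suml // => p _; apply: memvZ.
have [_ Fe Ff] := hF.
have pathF j : (psource p <= j <= h)%N ->
    exists a, F a = apath K h (psource p) j.
  elim: j => [|j IHj].
    by rewrite leqn0 => /andP[/eqP p0]; have := psource_gt0 p; rewrite p0.
  case/andP; rewrite leq_eqVlt ltnS => /predU1P[<- ph|pj jh].
    by exists (e (psource p)); rewrite Fe ?psource_gt0.
  have [|a aE] := IHj; first by rewrite pj ltnW.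
  have j0 : (0 < j)%N by rewrite (leq_trans (psource_gt0 p)).
  exists (a * f j); rewrite rmorphM /= aE Ff ?j0 // apathM ?psource_gt0 //.
  by rewrite pj leqnSn.
have [|a <-] := pathF (ptarget p); first by rewrite ptarget_ge leq_ord.
exact: img.
Qed.

End PathAlgebraHom.

Section LeftTail.
Variables (K : fieldType) (A : falgType K) (P : rmodule A) (h : nat).
Variables (e f : nat -> A) (F : {lrmorphism A -> pathalg K h}).
Hypothesis hF : realization_hom e f F.
Hypothesis hreal : left_realization P h e f.

Let h0 : (0 < h)%N. Proof. by case: hreal. Qed.
Let ee i : (1 <= i <= h)%N -> e i * e i = e i.
Proof. by case: hreal => _ [pe _] _ _ _ /pe[]. Qed.
Let efe i : (1 <= i < h)%N -> e i * f i * e i.+1 = f i.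
Proof. by case: hreal => _ _ _ _ hf /hf[]. Qed.
Let lt_le i : (1 <= i < h)%N -> (1 <= i <= h)%N.
Proof. by case/andP=> -> /ltnW. Qed.
Let lt_leS i : (1 <= i < h)%N -> (1 <= i.+1 <= h)%N.
Proof. by case/andP=> ? ->. Qed.
Let ef i : (1 <= i < h)%N -> e i * f i = f i.
Proof. by move=> hi; rewrite -(efe hi) -mulrA mulrA ee // lt_le. Qed.
Let fe i : (1 <= i < h)%N -> f i * e i.+1 = f i.
Proof. by move=> hi; rewrite -(efe hi) -mulrA ee // lt_leS. Qed.
Let Fe i : (1 <= i <= h)%N -> F (e i) = apath K h i i.
Proof. by case: hF => _ + _; apply. Qed.
Let Ff i : (1 <= i < h)%N -> F (f i) = apath K h i i.+1.
Proof. by case: hF => _ _; apply. Qed.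

Let c := 1 - \sum_(1 <= i < h.+1) e i.
Let Fc : F c = 0. Proof. by case: hF. Qed.

(** Induction from the simple module e_h A up to e_1 A.  The idempotent e_i is
    not congruent to an element of f_i A modulo the kernel, since t_i is not a
    multiple of the arrow out of i; so an element of e_i A in the kernel has the
    form f_i b, and b is in the kernel because multiplication by the arrow is
    injective on the paths from i + 1. *)
Lemma left_tail_inj i a : (1 <= i <= h)%N -> F (e i * a) = 0 -> e i * a = 0.
Proof.
have memW x : (x \in lker (linfun F)) = (F x == 0) by rewrite memv_ker lfunE.
have sW x b : x \in lker (linfun F) -> x * b \in lker (linfun F).
  by rewrite !memW rmorphM /= => /eqP->; rewrite mul0r.
suff {a} tail k :
    (k < h)%N -> forall a, F (e (h - k) * a) = 0 -> e (h - k) * a = 0.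
  case/andP=> i0 ih; rewrite -(subKn ih); apply: tail.
  by rewrite ltn_subrL i0 h0.
elim: k i => [_ _ a|k IHk _ kh a /eqP]; rewrite ?subn0.
  case: hreal => _ _ _ [_ simp] _ /eqP; rewrite -memW.
  apply: ker_simple_eA => //; first by rewrite /is_idempotent ee ?h0 /=.
  by rewrite memW Fe ?h0 ?leqnn // apath_neq0 // leqnn.
have hi : (1 <= h - k.+1 < h)%N by rewrite subn_gt0 kh ltn_subrL h0.
have iS : (h - k.+1).+1 = (h - k)%N by rewrite subnS prednK ?subn_gt0 // ltnW.
set i := (h - k.+1)%N in hi iS *.
case: hreal => _ _ _ _ /(_ i hi)[_ _ _ max]; rewrite -memW => Wa.
have [|b aE] := ker_step_eA (ee (lt_le hi)) sW (ef hi) max _ Wa.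
  move=> b; rewrite memW rmorphB /= rmorphM /= Fe ?lt_le // Ff // subr_eq0.
  apply/negP => /eqP/(congr1 (fun x => x * apath K h i i)).
  have [i0 ih] := andP hi; rewrite apathM ?leqnn ?(ltnW ih) //.
  rewrite -(@apathM K h i i.+1 i.+1) ?leqnn ?leqnSn //.
  rewrite -!mulrA [X in _ * X]mulrA apath_triangular ?leqnn // mulr0 => /eqP.
  by apply/negP; rewrite apath_neq0 // leqnn ltnW.
have := Wa; rewrite memW aE rmorphM /= Ff // => /eqP Fb.
have [i0 ih] := andP hi.
move: Fb; rewrite rmorphM /= Fe ?lt_leS // => Fb.
rewrite iS IHk ?mulr0 // 1?ltnW // -iS rmorphM /= Fe ?lt_leS //.
apply: (@apath_mull_eq0 K h i) => //.
by rewrite -[RHS]Fb mulrA apathM ?leqnSn ?leqnn.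
Qed.

(** No path leaves the tail: the element lies in the kernel of [F], which is
    trivial on e_i A. *)
Lemma left_tail_sink i a : (1 <= i <= h)%N -> e i * a * c = 0.
Proof.
by move=> hi; rewrite -mulrA left_tail_inj // !rmorphM /= Fc !mulr0.
Qed.

Lemma ker_left_tail a : F a = 0 -> c * a = a.
Proof.
move=> Fa; rewrite mulrBl mul1r mulr_suml big_nat big1 ?subr0 // => i hi.
by rewrite left_tail_inj // rmorphM /= Fa mulr0.
Qed.

(** As [F] is injective on e_i A, the decomposition of paths by their first
    arrow lifts to A. *)
Lemma left_tail_head i a : (1 <= i <= h)%N ->
  exists k b, e i * a = k *: e i + (if (i < h)%N then f i else 0) * b.
Proof.
move=> hi; have [i0 _] := andP hi; have [k [y Fy]] := apath_head (F a) i0.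
have [b bE] := realization_surj hF y; exists k, b; apply/eqP.
rewrite -subr_eq0; set t := if _ then _ else _.
have et : e i * t = t.
  by rewrite /t; case: ifP => [ih|]; rewrite ?mulr0 // ef ?i0.
have Ft : F t = apath K h i i.+1.
  rewrite /t; case: ifP => [ih|/negbT]; first by rewrite Ff ?i0.
  rewrite -leqNgt rmorph0 => hi'; apply/esym/ffunP => p; rewrite apathE ffunE.
  case: (ptarget p =P i.+1 :> nat) => [pt|]; last by rewrite andbF.
  by have := leq_ord (ptarget p); rewrite pt ltnNge hi'.
have -> : e i * a - (k *: e i + t * b) = e i * (a - (k *: e i + t * b)).
  by rewrite mulrBr mulrDr -scalerAr ee // mulrA et.
apply/eqP/left_tail_inj; rewrite // mulrBr mulrDr -scalerAr ee // mulrA et.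
by rewrite rmorphB rmorphD !rmorphM /= linearZ /= Fe // Ft bE Fy subrr.
Qed.

(** The product f_1 ... f_i, a generator of the submodule e_{i+1} A of e_1 A. *)
Fixpoint tail_path i := if i is j.+1 then tail_path j * f i else e 1%N.

Lemma tail_pathE i : (i < h)%N -> tail_path i * e i.+1 = tail_path i.
Proof. by case: i => [|i] ih /=; rewrite ?ee // -mulrA fe. Qed.

Lemma e_tail_path i : (i < h)%N -> e 1%N * tail_path i = tail_path i.
Proof. by elim: i => [|i IHi] ih /=; rewrite ?ee // mulrA IHi // ltnW. Qed.

Lemma tail_path_hom i : (i < h)%N -> F (tail_path i) = apath K h 1 i.+1.
Proof.
elim: i => [|i IHi] ih /=; first by rewrite Fe.
have ih' := ltnW ih.
by rewrite rmorphM /= IHi // Ff // apathM ?leqnSn.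
Qed.

Lemma tail_path_inj i a : (i < h)%N -> tail_path i * a = 0 -> e i.+1 * a = 0.
Proof.
move=> ih pa0; have Fa : apath K h 1 i.+1 * F a = 0.
  by rewrite -tail_path_hom // -rmorphM pa0 rmorph0.
apply: left_tail_inj => //; rewrite rmorphM /= Fe //.
exact: (@apath_mull_eq0 K h 1).
Qed.

Hypothesis hP : left_abutment P.

(** The abutment property for the projective u A and the submodule e_{i+1} A of
    P.  The module u A does not embed into P: an embedding would send the
    nonzero element u c into P c, which vanishes since no path leaves the tail.
    So the morphism e_{i+1} A -> u A given by x extends to P, and x is the image
    of the generator of P, multiplied by the path. *)
Lemma left_abutment_factor u x i : primitive_idem u -> (i < h)%N ->
  u * c <> 0 -> u * x = x -> x * e i.+1 = x -> exists z, x = z * tail_path i.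
Proof.
move=> pu ih uc0 ux xe.
have [_ uu _] := pu.
case: hreal => _ _ [phi [phiM bphi]] _ _.
have [psi [psiM phiK psiK]] := rmhom_inv phiM bphi.
have e1c : is_idempotent (e 1%N) by rewrite /is_idempotent ee.
have notP : ~ exists U : submodule P, rmisomorphic (eA u) (submod U).
  case=> U [xi [xiM bxi]]; case: uc0; pose y := eA_elt u 1.
  pose d := psi (vsval (xi y)).
  have d0 : d ** c = 0.
    apply: subvs_inj; rewrite eA_act linear0 -(eA_idem d e1c).
    by rewrite left_tail_sink ?h0.
  have : xi (y ** c) = 0.
    apply: subvs_inj; rewrite xiM sub_actE linear0 -[vsval _]psiK.
    by rewrite -phiM d0 linear0.
  rewrite -[0](linear0 xi) => /(bij_inj bxi)/(congr1 vsval).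
  by rewrite eA_act eA_eltE mulr1 linear0.
pose p0 := phi (eA_elt (e 1%N) (tail_path i)).
pose G := act_map p0; pose H := act_map (eA_elt u x).
have GM : @rmhom K A (regmod A) P G.
  by move=> a b; rewrite !act_mapE /= lfunE /= actM.
have sU := stable_limg GM.
(* G and H present p0 A = e_{i+1} A and x A as quotients of A; the
   kernel of G lies in that of H, which defines L : p0 a |-> x a. *)
have [L GH] : exists L : 'Hom(P, eA u), forall a, L (G a) = H a.
  exists (H \o G^-1)%VF => a; rewrite comp_lfunE; set b := (G^-1)%VF (G a).
  have : G b = G a by rewrite limg_lfunVK // memv_img ?memvf.
  rewrite !act_mapE /p0 -!phiM => /(bij_inj bphi)/(congr1 vsval).
  rewrite !eA_act !eA_eltE e_tail_path // => /eqP.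
  rewrite -subr_eq0 -mulrBr => /eqP/(tail_path_inj ih) eba.
  apply: subvs_inj; rewrite !eA_act !eA_eltE ux; apply/eqP.
  by rewrite -subr_eq0 -mulrBr -xe -mulrA eba mulr0.
case: hP => _ _ _.
move=> /(_ _ (indecomposable_eA pu) (projective_eA uu) notP (Submodule sU)).
case/(_ (L \o incl (Submodule sU))%VF) => [a y|g [gM gE]].
  rewrite !comp_lfunE !inclE sub_actE.
  have /memv_imgP[b _ ->] := subvsP y.
  have ba : rmod_act (regmod A) a b = b * a by rewrite /= lfunE.
  by rewrite -GM !GH !act_mapE ba actM.
pose y : submod (Submodule sU) := Subvs (memv_img G (memvf 1)).
exists (vsval (g (phi (eA_elt (e 1%N) 1)))).
have := gE y; rewrite comp_lfunE inclE GH act_mapE act1 => /(congr1 vsval).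
rewrite eA_eltE ux => ->; rewrite -eA_act -gM -phiM; congr (vsval (g _)).
rewrite /= act_mapE act1; congr (phi _); apply: subvs_inj.
by rewrite eA_act !eA_eltE mulr1.
Qed.

Hypothesis hA : basic A.

(** An element of the kernel c A that ends at i + 1 is split along the primitive
    idempotents u_j of A.  Those with u_j c = 0 do not contribute, and for the
    others the abutment property applies. *)
Lemma ker_factor i a : (1 <= i < h)%N -> F a = 0 ->
  exists2 b, F b = 0 & a * e i.+1 = b * f i.
Proof.
move=> hi Fa; have [i0 ih] := andP hi; pose x := a * e i.+1.
have cx : c * x = x by rewrite mulrA ker_left_tail.
suff [z xE] : exists z, x = z * tail_path i.
  exists (c * z * tail_path i.-1); first by rewrite !rmorphM /= Fc !mul0r.
  by rewrite -/x -cx xE -!mulrA -{1}(prednK i0) /= prednK.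
have xe : x * e i.+1 = x by rewrite /x -mulrA ee // lt_leS.
have [n [u [pu _ u1 _]]] := hA.
suff img j : u j * x \in limg (amulr (tail_path i)).
  have : x \in limg (amulr (tail_path i)).
    by rewrite -[x]mul1r -u1 mulr_suml memv_suml.
  by case/memv_imgP=> z _ ->; exists z; rewrite lfunE.
have [uc0|/eqP uc0] := eqVneq (u j * c) 0.
  by rewrite -cx mulrA uc0 mul0r mem0v.
have [_ uu _] := pu j.
have [||z ->] := left_abutment_factor (pu j) ih uc0 (x := u j * x).
- by rewrite mulrA uu.
- by rewrite -mulrA xe.
by have := memv_img (amulr (tail_path i)) (memvf z); rewrite lfunE.
Qed.

End LeftTail.

Section RightTail.
Variables (K : fieldType) (B : falgType K) (I : rmodule B) (h : nat).
Variables (e g : nat -> B) (F : {lrmorphism B -> pathalg K h}).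
Hypothesis hF : realization_hom e g F.
Hypothesis hreal : right_realization I h e g.

Let ee i : (1 <= i <= h)%N -> e i * e i = e i.
Proof. by case: hreal => _ [pe _] _ _ _ /pe[]. Qed.
Let ege i : (1 <= i < h)%N -> e i * g i * e i.+1 = g i.
Proof. by case: hreal => _ _ _ _ hg /hg[]. Qed.
Let Fe i : (1 <= i <= h)%N -> F (e i) = apath K h i i.
Proof. by case: hF => _ + _; apply. Qed.
Let Fg i : (1 <= i < h)%N -> F (g i) = apath K h i i.+1.
Proof. by case: hF => _ _; apply. Qed.

(** The mirror image of [left_tail_inj], for left ideals, read as right ideals
    of the opposite algebra: induction from the simple B eps_1 to B eps_h. *)
Lemma right_tail_inj i a : (1 <= i <= h)%N -> F (a * e i) = 0 -> a * e i = 0.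
Proof.
have memW x : (x \in lker (linfun F)) = (F x == 0) by rewrite memv_ker lfunE.
pose W : {vspace oppalg B} := lker (linfun F).
have sW (x b : oppalg B) : x \in W -> x * b \in W.
  by rewrite !memW oppalg_mulE rmorphM /= => /eqP->; rewrite mulr0.
case: i => // i /andP[_]; elim: i a => [|i IHi] a ih /eqP.
  case: hreal => _ _ _ /simple_of_dual simp _; rewrite -memW.
  apply: (@ker_simple_eA K (oppalg B) W) => //.
    by rewrite /is_idempotent oppalg_mulE ee.
  by rewrite memW Fe // apath_neq0.
have hi : (1 <= i.+1 < h)%N by [].
have eg : e i.+1 * g i.+1 = g i.+1.
  by rewrite -(ege hi) -mulrA mulrA ee // (ltnW ih).
have ge : g i.+1 * e i.+2 = g i.+1.
  by rewrite -(ege hi) -mulrA ee.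
case: hreal => _ _ _ _ /(_ _ hi)[_ _ _ /maximal_of_dual max].
rewrite -memW => Wa.
have [|b aE] := @ker_step_eA K (oppalg B) W _ _ (g i.+1)
  (ee (ih : 1 <= i.+2 <= h)%N) sW ge max _ a Wa.
  move=> b; rewrite memW oppalg_mulE rmorphB /= rmorphM /= Fe // Fg //.
  rewrite subr_eq0; apply/negP.
  move/eqP/(congr1 (fun x => apath K h i.+2 i.+2 * x)).
  rewrite apathM ?leqnn // mulrA.
  rewrite -(@apathM K h i.+1 i.+1 i.+2) ?leqnn ?leqnSn // mulrA.
  rewrite apath_triangular ?leqnn // mul0r => /eqP.
  by apply/negP; rewrite apath_neq0 // leqnn.
move: aE; rewrite !oppalg_mulE => aE; have := Wa.
rewrite memW aE rmorphM /= Fg // => /eqP Fb.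
rewrite IHi ?mul0r // 1?ltnW // rmorphM /= Fe ?(ltnW ih) //.
apply: (@apath_mulr_eq0 K h _ i.+2) => //.
move: Fb; rewrite rmorphM /= Fe ?(ltnW ih) // -mulrA.
by rewrite apathM ?leqnSn ?leqnn.
Qed.

Lemma ker_right_tail b : F b = 0 -> b * (1 - \sum_(1 <= i < h.+1) e i) = b.
Proof.
move=> Fb; rewrite mulrBr mulr1 mulr_sumr big_nat big1 ?subr0 // => i hi.
by rewrite right_tail_inj // rmorphM /= Fb mul0r.
Qed.

End RightTail.

(** * Modules over a quotient algebra *)

Section Inflation.
Variables (K : fieldType) (R A : falgType K) (p : 'Hom(R, A)).
Hypothesis pM : forall a b : R, p (a * b) = p a * p b.
Hypothesis p1 : p 1 = 1.
Hypothesis p_surj : limg p = fullv.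

Let s : 'Hom(A, R) := (p^-1)%VF.
Let sK a : p (s a) = a.
Proof. by rewrite limg_lfunVK // p_surj memvf. Qed.

Section Deflation.
Variables (M : rmodule R) (kM : modmul M (lker p) = 0%VS).

Let congM (x : M) a b : p a = p b -> x ** a = x ** b.
Proof.
move=> pab; apply/eqP; rewrite -subr_eq0 -actB -memv0 -kM mem_modmul //.
by rewrite memv_ker linearB /= pab subrr.
Qed.

(** Any linear section of [p] defines the action of A, as M is killed by the
    kernel of [p]. *)
Definition defl_act (a : A) : 'End(M) := rmod_act M (s a).

Fact defl_act_linear : linear defl_act.
Proof. by move=> k a b; rewrite /defl_act !linearP. Qed.

HB.instance Definition _ :=
  GRing.isLinear.Build K A 'End(M) _ defl_act defl_act_linear.

Fact defl_act1 : defl_act 1 = \1%VF.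
Proof.
by apply/lfunP => x; rewrite -(rmod_act1 M); apply: congM; rewrite sK p1.
Qed.

Fact defl_actM a b : defl_act (a * b) = (defl_act b \o defl_act a)%VF.
Proof.
apply/lfunP => x; rewrite comp_lfunE /defl_act -actM; apply: congM.
by rewrite pM !sK.
Qed.

Definition defl : rmodule A := RModule defl_act1 defl_actM.

Lemma deflE (x : M) a : rmod_act defl (p a) x = x ** a.
Proof. by apply: congM; rewrite sK. Qed.

Lemma indecomposable_defl : indecomposable M -> indecomposable defl.
Proof.
case=> M0 iM; split=> // U V; apply: (@indecomposableP _ _ M) => //.
  by move=> a x Ux; have := @sub_stable _ _ _ U (p a) x Ux; rewrite deflE.
by move=> a x Vx; have := @sub_stable _ _ _ V (p a) x Vx; rewrite deflE.
Qed.

End Deflation.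

Lemma rmhom_defl (M N : rmodule R) kM kN (f : 'Hom(M, N)) :
  rmhom f -> @rmhom _ _ (@defl M kM) (@defl N kN) f.
Proof. by move=> fM a x; rewrite -[a]sK !deflE fM. Qed.

(** The configuration excluded by [representation_directed]. *)
Definition cycle_in (X : falgType K) (t : nat) (M : nat -> rmodule X) : Prop :=
  [/\ (0 < t)%N,
      forall i, (i <= t)%N -> indecomposable (M i),
      forall i, (i < t)%N -> exists f : 'Hom(M i, M i.+1),
        [/\ rmhom f, f <> 0 & ~ bijective f]
    & rmisomorphic (M 0%N) (M t)].

Lemma no_inflated_cycle t (M : nat -> rmodule R) :
  representation_directed A ->
  (forall i, (i <= t)%N -> modmul (M i) (lker p) = 0%VS) -> ~ cycle_in t M.
Proof.
move=> dA kM [t0 iM homM isoM]; apply: dA.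
(* Frozen at t, the whole sequence consists of A-modules. *)
have k i : modmul (M (minn i t)) (lker p) = 0%VS by rewrite kM ?geq_minr.
exists t, (fun i => defl (k i)); split=> // [i _|i it|].
- by apply: indecomposable_defl; apply: iM; apply: geq_minr.
- have [f [fM f0 fb]] : exists f : 'Hom(M (minn i t), M (minn i.+1 t)),
      [/\ rmhom f, f <> 0 & ~ bijective f].
    by rewrite (minn_idPl it) (minn_idPl (ltnW it)); apply: homM.
  by exists f; split=> //; apply: rmhom_defl.
have [f [fM bf]] : rmisomorphic (M (minn 0 t)) (M (minn t t)).
  by rewrite min0n minnn.
by exists f; split=> //; apply: rmhom_defl.
Qed.

End Inflation.

(** * Cycles stay on one side *)

Section Cycles.
Variables (K : fieldType) (R A B : falgType K).
Variables (pA : 'Hom(R, A)) (pB : 'Hom(R, B)).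
Hypotheses (pAM : forall a b : R, pA (a * b) = pA a * pA b) (pA1 : pA 1 = 1)
  (pAs : limg pA = fullv).
Hypotheses (pBM : forall a b : R, pB (a * b) = pB a * pB b) (pB1 : pB 1 = 1)
  (pBs : limg pB = fullv).
Hypothesis dichotomy : forall M : rmodule R, indecomposable M ->
  modmul M (lker pB) = 0%VS \/
  modmul M (lker pB) = fullv /\ modmul M (lker pA) = 0%VS.

(** If f killed M J = M it would be zero. *)
Lemma modmul_propagate (M N : rmodule R) (f : 'Hom(M, N)) : indecomposable M ->
  rmhom f -> f <> 0 -> modmul M (lker pB) <> 0%VS -> modmul N (lker pB) <> 0%VS.
Proof.
move=> /dichotomy[-> //|[Mf _]] fM f0 _ N0; case: f0; apply/lfunP => x.
have := @modmul_hom _ _ _ _ f (lker pB) x fM.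
rewrite Mf N0 memvf memv0 => /(_ isT).
by move/eqP->; rewrite zero_lfunE.
Qed.

(** The modules with M J <> 0 propagate along the cycle, which closes up; so
    either all of them or none of them satisfy this. *)
Lemma directed_of_dichotomy :
  representation_directed A -> representation_directed B ->
  representation_directed R.
Proof.
move=> dA dB [t [M cyc]]; have [t0 iM homM [g [gM bg]]] := cyc.
have step i : (i < t)%N -> modmul (M i) (lker pB) <> 0%VS ->
    modmul (M i.+1) (lker pB) <> 0%VS.
  move=> it; have [f [fM f0 _]] := homM i it.
  exact: modmul_propagate (iM i (ltnW it)) fM f0.
have up i j : (i <= j <= t)%N -> modmul (M i) (lker pB) <> 0%VS ->
    modmul (M j) (lker pB) <> 0%VS.
  case/andP; elim: j => [|j IHj]; first by rewrite leqn0 => /eqP->.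
  rewrite leq_eqVlt ltnS => /predU1P[-> //|ij] jt Mi.
  by apply: step => //; apply: IHj; rewrite // ltnW.
have [g' [g'M gK g'K]] := rmhom_inv gM bg.
have back : modmul (M t) (lker pB) <> 0%VS -> modmul (M 0%N) (lker pB) <> 0%VS.
  apply: modmul_propagate (iM t (leqnn t)) g'M _ => g'0.
  case: (iM t (leqnn t)) => ft _; apply: ft; apply/eqP; rewrite -subv0.
  by apply/subvP => x _; rewrite -[x]g'K g'0 zero_lfunE linear0 mem0v.
have [M0|/eqP M0] := eqVneq (modmul (M 0%N) (lker pB)) 0%VS.
  apply: (no_inflated_cycle pBM pB1 pBs dB _ cyc) => i it.
  apply/eqP; apply: contraT => /eqP Mi; case: (back _) => //.
  by apply: up Mi; rewrite it leqnn.
apply: (no_inflated_cycle pAM pA1 pAs dA _ cyc) => i it.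
have [Mi|[]//] := dichotomy (iM i it).
by case: (up 0%N i _ M0 Mi).
Qed.

End Cycles.

(** * The gluing *)

Section GluingProjections.
Variables (K : fieldType) (A B : falgType K) (h : nat).
Variable fP : {lrmorphism A -> pathalg K h}.
Variable gI : {lrmorphism B -> pathalg K h}.
Local Notation L := (gluing fP gI).

Definition gluing_fst (x : L) : A := (vsval x : A * B).1.
Definition gluing_snd (x : L) : B := (vsval x : A * B).2.

Fact gluing_fst_linear : linear gluing_fst. Proof. by []. Qed.
HB.instance Definition _ :=
  GRing.isLinear.Build K L A _ gluing_fst gluing_fst_linear.
Fact gluing_snd_linear : linear gluing_snd. Proof. by []. Qed.
HB.instance Definition _ :=
  GRing.isLinear.Build K L B _ gluing_snd gluing_snd_linear.

Definition pr1 : 'Hom(L, A) := linfun gluing_fst.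
Definition pr2 : 'Hom(L, B) := linfun gluing_snd.

Lemma vsval_gluing1 : vsval (1 : L) = 1.
Proof. by apply/eqP; rewrite algid_eq1 memv_gluing !rmorph1. Qed.

Lemma pr1_1 : pr1 1 = 1.
Proof. by rewrite lfunE /= /gluing_fst vsval_gluing1. Qed.
Lemma pr2_1 : pr2 1 = 1.
Proof. by rewrite lfunE /= /gluing_snd vsval_gluing1. Qed.
Lemma pr1M x y : pr1 (x * y) = pr1 x * pr1 y.
Proof. by rewrite !lfunE. Qed.
Lemma pr2M x y : pr2 (x * y) = pr2 x * pr2 y.
Proof. by rewrite !lfunE. Qed.

Lemma pr_inj x y : pr1 x = pr1 y -> pr2 x = pr2 y -> x = y.
Proof.
rewrite !lfunE => x1 x2; apply: subvs_inj.
rewrite [LHS]surjective_pairing [RHS]surjective_pairing; congr pair => //.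
Qed.

Lemma prP x : fP (pr1 x) = gI (pr2 x).
Proof. by rewrite !lfunE; apply/eqP; rewrite -memv_gluing; case: x. Qed.

Lemma gluing_pair a b : fP a = gI b -> {x : L | pr1 x = a & pr2 x = b}.
Proof.
move/eqP; rewrite -(memv_gluing fP gI (a, b)) => ab.
by exists (Subvs ab); rewrite lfunE.
Qed.

End GluingProjections.

Section GluingDichotomy.
Variables (K : fieldType) (A B : falgType K) (h : nat).
Variables (P : rmodule A) (I : rmodule B).
Variables (e f : nat -> A) (eps g : nat -> B).
Variable fP : {lrmorphism A -> pathalg K h}.
Variable gI : {lrmorphism B -> pathalg K h}.
Hypotheses (hA : basic A) (hP : left_abutment P).
Hypothesis hPreal : left_realization P h e f.
Hypothesis hIreal : right_realization I h eps g.
Hypotheses (hfP : realization_hom e f fP) (hgI : realization_hom eps g gI).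
Local Notation L := (gluing fP gI).
Local Notation p1 := (pr1 fP gI).
Local Notation p2 := (pr2 fP gI).

Lemma pr1_surj : limg p1 = fullv.
Proof.
apply/vspaceP => a; rewrite memvf; have [b bE] := realization_surj hgI (fP a).
by have [x <- _] := gluing_pair (esym bE); rewrite memv_img ?memvf.
Qed.

Lemma pr2_surj : limg p2 = fullv.
Proof.
apply/vspaceP => b; rewrite memvf; have [a aE] := realization_surj hfP (gI b).
by have [x _ <-] := gluing_pair aE; rewrite memv_img ?memvf.
Qed.

(** The splitting applies with E_i = (e_i, eps_i), with the arrows (f_i, g_i)
    and with (0, c') as right unit of Q. *)
Lemma gluing_dichotomy (M : rmodule L) : indecomposable M ->
  modmul M (lker p2) = 0%VS \/
  modmul M (lker p2) = fullv /\ modmul M (lker p1) = 0%VS.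
Proof.
have [fPc fPe fPf] := hfP; have [gIc gIe gIg] := hgI.
have [_ [pe _] _ _ hf] := hPreal; have [_ [peps _] _ _ hg] := hIreal.
have ideal1 (a b : L) : a \in lker p1 -> a * b \in lker p1.
  by rewrite !memv_ker pr1M => /eqP->; rewrite mul0r.
have ideal2 (a b : L) : a \in lker p2 -> a * b \in lker p2.
  by rewrite !memv_ker pr2M => /eqP->; rewrite mul0r.
have zero (x : L) : p1 x = 0 -> p2 x = 0 -> x = 0.
  by move=> x1 x2; apply: pr_inj; rewrite ?x1 ?x2 linear0.
have EX i : {x : L | (1 <= i <= h)%N -> p1 x = e i /\ p2 x = eps i}.
  have [hi|] := boolP (1 <= i <= h)%N; last by exists 0.
  have ee : fP (e i) = gI (eps i) by rewrite fPe ?gIe.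
  by have [x x1 x2] := gluing_pair ee; exists x.
have alX i : {x : L | p1 x = (if (1 <= i < h)%N then f i else 0)
                    & p2 x = (if (1 <= i < h)%N then g i else 0)}.
  case: (boolP (1 <= i < h)%N) => hi; last by exists 0; rewrite linear0.
  have ff : fP (f i) = gI (g i) by rewrite fPf ?gIg.
  by have [x x1 x2] := gluing_pair ff; exists x.
pose E i := sval (EX i); pose al i := s2val (alX i).
have E_1 i : (1 <= i <= h)%N -> p1 (E i) = e i by case/(svalP (EX i)).
have E_2 i : (1 <= i <= h)%N -> p2 (E i) = eps i by case/(svalP (EX i)).
have al_1 i : p1 (al i) = (if (1 <= i < h)%N then f i else 0).
  exact: s2valP (alX i).
have al_2 i : p2 (al i) = (if (1 <= i < h)%N then g i else 0).
  exact: s2valP' (alX i).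
have [eQ eQ1 eQ2] : {x : L | p1 x = 0 & p2 x = 1 - \sum_(1 <= i < h.+1) eps i}.
  by apply: gluing_pair; rewrite gIc rmorph0.
have leS i : (1 <= i < h)%N -> (1 <= i.+1 <= h)%N by case/andP=> _ ->.
have ltW i : (1 <= i < h)%N -> (1 <= i <= h)%N by case/andP=> -> /ltnW.
have ee i : (1 <= i <= h)%N -> e i * e i = e i by case/pe.
have ss i : (1 <= i <= h)%N -> eps i * eps i = eps i by case/peps.
apply: (@indecomposable_modmul K L (lker p2) (lker p1) h E al eQ) => //.
- move=> a b; rewrite !memv_ker => /eqP a2 /eqP b1.
  by apply: zero; rewrite ?pr1M ?pr2M ?b1 ?a2 ?mulr0 ?mul0r.
- move=> b; rewrite memv_ker => /eqP b1; apply: pr_inj; rewrite ?pr1M ?pr2M.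
    by rewrite b1 mul0r.
  by rewrite eQ2 (ker_right_tail hgI hIreal) // -prP b1 rmorph0.
- by rewrite memv_ker eQ1.
- by move=> i hi; apply: pr_inj; rewrite ?pr1M ?pr2M ?E_1 ?E_2 ?ee ?ss.
- rewrite -(subrK eQ (1 - _)) memv_add ?memv_ker ?eQ1 // !linearB /=.
  rewrite eQ2 pr2_1 linear_sum /=.
  by rewrite (eq_big_nat _ _ (F2 := eps)) ?subrr // => i hi; rewrite E_2.
- move=> i hi; have [efe _ _ _] := hf i hi; have [ege _ _ _] := hg i hi.
  apply: pr_inj; rewrite ?pr1M ?pr2M ?E_1 ?E_2 ?ltW // ?al_1 ?al_2 hi.
    by rewrite -efe !mulrA ee ?ltW.
  by rewrite -ege !mulrA ss ?ltW.
- move=> i hi; have [efe _ _ _] := hf i hi; have [ege _ _ _] := hg i hi.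
  apply: pr_inj; rewrite ?pr1M ?pr2M ?E_1 ?E_2 ?leS // ?al_1 ?al_2 hi.
    by rewrite -efe -!mulrA ee ?leS.
  by rewrite -ege -!mulrA ss ?leS.
- by apply: zero; rewrite ?al_1 ?al_2 ltnn andbF.
- move=> i a hi; have [k [a' aE]] := left_tail_head hfP hPreal (p1 a) hi.
  have [b] : exists b, p1 b = a'.
    have /memv_imgP[b _ ->] : a' \in limg p1 by rewrite pr1_surj memvf.
    by exists b.
  move=> bE; exists k, b; rewrite memv_ker linearB linearD linearZ /= !pr1M.
  rewrite E_1 // al_1 bE aE; case/andP: hi => -> _ /=.
  by rewrite subrr.
- move=> i a hi; rewrite memv_ker => /eqP a2.
  have a1 : fP (p1 a) = 0 by rewrite prP a2 rmorph0.
  have [b' b0 aE] := ker_factor hfP hPreal hP hA hi a1.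
  have [|b b1 b2] := @gluing_pair _ _ _ _ fP gI b' 0.
    by rewrite b0 rmorph0.
  exists b; first by rewrite memv_ker b2.
  apply: pr_inj; rewrite ?pr1M ?pr2M ?E_1 ?leS // ?al_1 ?b1 ?hi //.
  by rewrite a2 b2 !mul0r.
Qed.

End GluingDichotomy.

Theorem corollary2p36 (K : closedFieldType) (A B : falgType K)
    (hA : basic A) (hB : basic B)
    (hdA : representation_directed A) (hdB : representation_directed B)
    (P : rmodule A) (I : rmodule B)
    (hP : left_abutment P) (hI : right_abutment I)
    (h : nat) (e f : nat -> A) (eps g : nat -> B)
    (hPreal : left_realization P h e f)
    (hIreal : right_realization I h eps g)
    (fP : {lrmorphism A -> pathalg K h}) (gI : {lrmorphism B -> pathalg K h})
    (hfP : realization_hom e f fP) (hgI : realization_hom eps g gI) :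
  representation_directed (gluing fP gI).
Proof.
apply: (directed_of_dichotomy (@pr1M _ _ _ _ fP gI) (pr1_1 fP gI)
  (pr1_surj fP hgI) (@pr2M _ _ _ _ fP gI) (pr2_1 fP gI)
  (pr2_surj gI hfP)) => //.
exact: gluing_dichotomy hA hP hPreal hIreal hfP hgI.
Qed.
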